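(* There is an absolute constant $C>0$ such that the following holds. Let $n\in\mathbb{N}$, let $A\in\mathbb{R}^{n\times n}$ be a symmetric matrix of rank $r\in\{1,\dots,n\}$, and let $\{X_a\}_{a=1}^{n^2}$ be an orthonormal basis of $\mathbb{R}^{n\times n}$ with respect to the Frobenius inner product (the matrices $X_a$ need not be symmetric). Suppose that $A$ has coherence $\nu>0$ with respect to $\{X_a\}_{a=1}^{n^2}$ (defined in the context). Let $\beta>0$ and let $m\le n^2$ be a natural number with $$m\ge C\,n r\nu(1+\beta)\ln^2 n .$$ Let $\Omega\subset\{1,\dots,n^2\}$ be chosen uniformly at random among all subsets of $\{1,\dots,n^2\}$ with $m$ elements. Then, with probability at least $1-n^{-\beta}$, the minimization problem $$\min_{Z\in\mathbb{R}^{n\times n}}\|Z\|_*\quad\text{subject to}\quad \langle X_a,Z\rangle_F=\langle X_a,A\rangle_F\ \text{ for all } a\in\Omega$$ has a unique solution, and this solution equals $A$.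
   Context: $\langle A,B\rangle_F=\sum_{j,k}A_{j,k}B_{j,k}$ is the Frobenius inner product, $\|\cdot\|_F$ the Frobenius norm, $\|\cdot\|$ the spectral (operator) norm and $\|\cdot\|_*$ the nuclear norm (sum of the singular values). For a symmetric matrix $A$ of rank $r$ put $U=\mathrm{range}(A)$, let $P_U$ and $P_{U^\perp}$ be the orthogonal projections onto $U$ and $U^\perp$, and let $T=\{Z\in\mathbb{R}^{n\times n}:P_{U^\perp}ZP_{U^\perp}=0\}$. Let $\mathcal{P}_T$ be the orthogonal projection onto $T$, i.e. $\mathcal{P}_T(Z)=P_UZ+ZP_U-P_UZP_U$. The matrix $\mathrm{sgn}(A)$ is obtained by applying the sign function (with $\mathrm{sgn}(0)=0$) to $A$ by the spectral calculus. Definition (coherence). The rank-$r$ matrix $A\in\mathbb{R}^{n\times n}$ has coherence $\nu>0$ with respect to the basis $\{X_a\}_{a=1}^{n^2}$ if either $$\max_a\|X_a\|^2\le\frac{\nu}{n},$$ or $$\max_a\|\mathcal{P}_TX_a\|_F^2\le\frac{2\nu r}{n}\quad\text{and}\quad \max_a\langle X_a,\mathrm{sgn}(A)\rangle_F^2\le\frac{\nu r}{n^2}.$$ *)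

(* Defs.v *)
From HB Require Import structures.
From mathcomp Require Import all_boot all_order all_algebra.
From mathcomp Require Import all_classical all_reals all_analysis.

Set Implicit Arguments.
Unset Strict Implicit.
Unset Printing Implicit Defensive.

Import Order.TTheory GRing.Theory Num.Theory.

Local Open Scope ring_scope.

Definition frob (R : realType) (m n : nat) (A B : 'M[R]_(m, n)) : R :=
  \sum_(j < m) \sum_(k < n) A j k * B j k.

(* On column vectors this is the Euclidean norm. *)
Definition frob_norm (R : realType) (m n : nat) (A : 'M[R]_(m, n)) : R :=
  Num.sqrt (frob A A).

Definition spectral_norm (R : realType) (n : nat) (A : 'M[R]_n) : R :=
  sup [set frob_norm (A *m x) | x in [set x : 'cV[R]_n | frob_norm x <= 1]]%classic.

(* The singular values of Z are the square roots of the eigenvalues of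
   Z^T *m Z; since this matrix is symmetric, the multiplicity of an eigenvalue
   is the dimension of its eigenspace. The sum runs over the finite set of
   distinct eigenvalues. *)
Definition nuclear_norm (R : realType) (n : nat) (Z : 'M[R]_n) : R :=
  \sum_(l \in [set l : R | eigenvalue (Z^T *m Z) l]%classic)
    Num.sqrt l *+ \rank (eigenspace (Z^T *m Z) l).

(* Matrix of the orthogonal projection onto the row space of W: the projection
   along the row kernel of W^T, i.e. along the vectors orthogonal to every row
   of W. This matrix is symmetric, so it may be applied on either side. *)
Definition orth_proj (R : realType) (n : nat) (W : 'M[R]_n) : 'M[R]_n :=
  proj_mx W (kermx W^T).

(* The range (column space) of A is the row space of A^T. *)
Definition range_proj (R : realType) (n : nat) (A : 'M[R]_n) : 'M[R]_n :=
  orth_proj A^T.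

Definition tangent_proj (R : realType) (n : nat) (A Z : 'M[R]_n) : 'M[R]_n :=
  range_proj A *m Z + Z *m range_proj A - range_proj A *m Z *m range_proj A.

(* f(A) = sum of f(l) P_l over the distinct eigenvalues l of A, where P_l is the
   orthogonal projection onto the eigenspace of l. Meant for symmetric A. *)
Definition spectral_calculus (R : realType) (n : nat) (f : R -> R)
    (A : 'M[R]_n) : 'M[R]_n :=
  \sum_(l \in [set l : R | eigenvalue A l]%classic)
    f l *: orth_proj (eigenspace A l).

Definition sgnmx (R : realType) (n : nat) (A : 'M[R]_n) : 'M[R]_n :=
  spectral_calculus Num.sg A.

Definition orthonormal_basis (R : realType) (n : nat)
    (X : 'I_(n ^ 2) -> 'M[R]_n) : Prop :=
  basis_of {:'M[R]_n} [seq X a | a : 'I_(n ^ 2)] /\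
  forall a b, frob (X a) (X b) = (a == b)%:R.

Definition has_coherence (R : realType) (n : nat) (A : 'M[R]_n)
    (X : 'I_(n ^ 2) -> 'M[R]_n) (nu : R) : Prop :=
  (forall a, spectral_norm (X a) ^+ 2 <= nu / n%:R) \/
  ((forall a, frob_norm (tangent_proj A (X a)) ^+ 2
                <= 2 * nu * (\rank A)%:R / n%:R) /\
   (forall a, frob (X a) (sgnmx A) ^+ 2 <= nu * (\rank A)%:R / n%:R ^+ 2)).

(* Probability of the event E when Omega is uniformly distributed among the
   subsets of 'I_N with m elements. *)
Definition prob_subset (R : realType) (N m : nat)
    (E : {set 'I_N} -> Prop) : R :=
  #|[pred Omega : {set 'I_N} | (#|Omega| == m) && `[< E Omega >]]|%:R /
  #|[pred Omega : {set 'I_N} | #|Omega| == m]|%:R.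

Definition feasible (R : realType) (n : nat) (A : 'M[R]_n)
    (X : 'I_(n ^ 2) -> 'M[R]_n) (Omega : {set 'I_(n ^ 2)}) (Z : 'M[R]_n) : Prop :=
  forall a, a \in Omega -> frob (X a) Z = frob (X a) A.

Definition is_minimizer (R : realType) (n : nat) (A : 'M[R]_n)
    (X : 'I_(n ^ 2) -> 'M[R]_n) (Omega : {set 'I_(n ^ 2)}) (Z : 'M[R]_n) : Prop :=
  feasible A X Omega Z /\
  forall Y, feasible A X Omega Y -> nuclear_norm Z <= nuclear_norm Y.

(* Main.v *)
Require Import Defs.
From HB Require Import structures.
From mathcomp Require Import all_boot all_order all_algebra perm.
From mathcomp Require Import all_classical all_reals all_analysis.
From mathcomp Require Import complex ring lra.

Set Implicit Arguments.
Unset Strict Implicit.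
Unset Printing Implicit Defensive.

Import Order.TTheory GRing.Theory Num.Theory.

Local Open Scope ring_scope.

(** Gross's golfing scheme.  The random set is compared with the range of L batches
    of K independent uniform draws.  Starting from Z = sgn A, each batch replaces Z by
    Z - P_T (R Z), where R is the normalised sampling operator of the batch; with high
    probability this halves Z (and its coordinates, in the second coherence case) while
    the part of R Z normal to T has operator norm at most a quarter of the scale of Z.
    The sum Y of all R Z is supported on the sampled coordinates, its tangential part is
    within 2^-L sqrt r of sgn A, and its normal part has norm at most 1/2, which
    certifies A as the unique minimizer.

    The three events of a batch follow from a matrix Bernstein inequality.  Instead of
    matrix exponentials, its proof bounds E tr S^(2p) for a sum S of independent centered
    symmetric matrices by the method of exchangeable pairs: resampling one draw turns
    E tr (x_k S^(2p-1)) into the trace of (S - S')(S^(2p-1) - S'^(2p-1)), which is at most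
    (2p-1)/2 times the trace of (S - S')^2 (S^(2p-2) + S'^(2p-2)), and Young's inequality
    then reduces the moment of S to one of its quadratic variation. *)

(** * Frobenius inner product *)


(** The two logarithms in the sample size have separate origins. The certificate asks for a
    tangential error of order 1/n, hence for L of order ln n halvings. Each batch needs K of order n
    r nu p, where the moment order p is of order (1 + beta) ln n: the tail 4^-p has to beat the
    dimension n^2 and still leave n^-beta. At this order, moments serve as well as exponentials.

    Fresh batches are essential: the matrix Z of a step depends on the earlier draws, while the tail
    bounds concern a fixed Z, so the failure of a batch is bounded uniformly over all states that
    satisfy an invariant. A random m-subset offers no such independence. It can be compared with
    draws because recovery is monotone in the set of constraints and repeated draws only make the
    range smaller.

    Norms occur squared throughout, as [frob M M], and an operator norm bound is a quadratic
    inequality |Mu|^2 <= c |u|^2 for all u. Halving therefore appears as a factor 1/4, and a quarter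
    of the scale as 1/16. *)

Lemma frobE (R : realType) (m n : nat) (A B : 'M[R]_(m, n)) :
  frob A B = \tr (A^T *m B).
Proof.
rewrite /mxtrace /frob exchange_big /=; apply: eq_bigr => j _.
by rewrite mxE; apply: eq_bigr => i _; rewrite mxE.
Qed.

Lemma frobC (R : realType) (m n : nat) (A B : 'M[R]_(m, n)) :
  frob A B = frob B A.
Proof. by rewrite /frob; under eq_bigr do under eq_bigr do rewrite mulrC. Qed.

Lemma frobDr (R : realType) (m n : nat) (A B C : 'M[R]_(m, n)) :
  frob A (B + C) = frob A B + frob A C.
Proof. by rewrite !frobE mulmxDr mxtraceD. Qed.

Lemma frobZr (R : realType) (m n : nat) (c : R) (A B : 'M[R]_(m, n)) :
  frob A (c *: B) = c * frob A B.
Proof. by rewrite !frobE -scalemxAr mxtraceZ. Qed.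

Lemma frobNr (R : realType) (m n : nat) (A B : 'M[R]_(m, n)) :
  frob A (- B) = - frob A B.
Proof. by rewrite -scaleN1r frobZr mulN1r. Qed.

Lemma frobBr (R : realType) (m n : nat) (A B C : 'M[R]_(m, n)) :
  frob A (B - C) = frob A B - frob A C.
Proof. by rewrite frobDr frobNr. Qed.

Lemma frobDl (R : realType) (m n : nat) (A B C : 'M[R]_(m, n)) :
  frob (A + B) C = frob A C + frob B C.
Proof. by rewrite !(frobC _ C) frobDr. Qed.

Lemma frobZl (R : realType) (m n : nat) (c : R) (A B : 'M[R]_(m, n)) :
  frob (c *: A) B = c * frob A B.
Proof. by rewrite !(frobC _ B) frobZr. Qed.

Lemma frobNl (R : realType) (m n : nat) (A B : 'M[R]_(m, n)) :
  frob (- A) B = - frob A B.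
Proof. by rewrite !(frobC _ B) frobNr. Qed.

Lemma frobBl (R : realType) (m n : nat) (A B C : 'M[R]_(m, n)) :
  frob (A - B) C = frob A C - frob B C.
Proof. by rewrite !(frobC _ C) frobBr. Qed.

Lemma frob0r (R : realType) (m n : nat) (A : 'M[R]_(m, n)) : frob A 0 = 0.
Proof. by rewrite frobE mulmx0 mxtrace0. Qed.

Lemma frob0l (R : realType) (m n : nat) (A : 'M[R]_(m, n)) : frob 0 A = 0.
Proof. by rewrite frobC frob0r. Qed.

Lemma frob_sumr (R : realType) (m n : nat) (I : finType) (A : 'M[R]_(m, n))
    (F : I -> 'M[R]_(m, n)) :
  frob A (\sum_i F i) = \sum_i frob A (F i).
Proof. by rewrite frobE mulmx_sumr raddf_sum; apply: eq_bigr => i _; rewrite frobE. Qed.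

Lemma frob_suml (R : realType) (m n : nat) (I : finType) (A : 'M[R]_(m, n))
    (F : I -> 'M[R]_(m, n)) :
  frob (\sum_i F i) A = \sum_i frob (F i) A.
Proof. by rewrite frobC frob_sumr; apply: eq_bigr => i _; rewrite frobC. Qed.

Lemma frob_ge0 (R : realType) (m n : nat) (A : 'M[R]_(m, n)) : 0 <= frob A A.
Proof. by apply: sumr_ge0 => i _; apply: sumr_ge0 => j _; exact: sqr_ge0. Qed.

Lemma frob_eq0 (R : realType) (m n : nat) (A : 'M[R]_(m, n)) :
  (frob A A == 0) = (A == 0).
Proof.
apply/eqP/eqP => [|->]; last exact: frob0r.
move=> /eqP; rewrite /frob psumr_eq0; last first.
  by move=> i _; apply: sumr_ge0 => j _; exact: sqr_ge0.
move=> /allP h; apply/matrixP => i j; rewrite mxE.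
have /= := h i (mem_index_enum _); rewrite psumr_eq0; last by move=> k _; exact: sqr_ge0.
by move=> /allP /(_ j (mem_index_enum _)) /=; rewrite mulf_eq0 orbb => /eqP.
Qed.

Lemma frob_trmx (R : realType) (m n : nat) (A B : 'M[R]_(m, n)) :
  frob A^T B^T = frob A B.
Proof. by rewrite !frobE trmxK mxtrace_mulC -mxtrace_tr trmx_mul trmxK. Qed.

Lemma frob_mull (R : realType) (m n p : nat) (A : 'M[R]_(m, n)) (B : 'M[R]_(n, p)) C :
  frob (A *m B) C = frob B (A^T *m C).
Proof. by rewrite !frobE trmx_mul mulmxA. Qed.

Lemma frob_mulr (R : realType) (m n p : nat) (A : 'M[R]_(m, n)) (B : 'M[R]_(n, p)) C :
  frob (A *m B) C = frob A (C *m B^T).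
Proof. by rewrite !frobE trmx_mul -mulmxA mxtrace_mulC mulmxA. Qed.

Lemma frob_normK (R : realType) (m n : nat) (A : 'M[R]_(m, n)) :
  frob_norm A ^+ 2 = frob A A.
Proof. by rewrite sqr_sqrtr ?frob_ge0. Qed.

Lemma frob_cauchy (R : realType) (m n : nat) (A B : 'M[R]_(m, n)) :
  frob A B ^+ 2 <= frob A A * frob B B.
Proof.
have [->|B0] := eqVneq B 0; first by rewrite !frob0r expr0n mulr0.
have b0 : 0 < frob B B by rewrite lt_neqAle frob_ge0 eq_sym frob_eq0 B0.
have := frob_ge0 (frob B B *: A - frob A B *: B).
rewrite !(frobBl, frobBr, frobZl, frobZr) (frobC B A).
set a := frob A A; set b := frob B B in b0 *; set c := frob A B => h.
have : 0 <= b * (a * b - c ^+ 2) by lra.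
by rewrite pmulr_rge0 // subr_ge0.
Qed.

(** The complexified matrix has an eigenvector x + iy with eigenvalue a + ib. Comparing <xA, y> with
    <x, yA> gives b (|x|^2 + |y|^2) = 0, so b = 0, and whichever of x and y is nonzero is a real
    eigenvector. *)
Lemma sym_has_eigenvalue (R : realType) (n : nat) (A : 'M[R]_n.+1) :
  A^T = A -> exists a, eigenvalue A a.
Proof.
move=> symA; pose f := @real_complex R; pose Ac := map_mx f A.
have /closed_rootP [z] : size (char_poly Ac) != 1%N by rewrite size_char_poly.
case: z => a b; rewrite -eigenvalue_root_char => /eigenvalueP [v vA v0].
pose x := map_mx (@complex.Re R) v; pose y := map_mx (@complex.Im R) v.
have vE i j : v i j = (x i j +i* y i j)%C by rewrite !mxE; case: (v i j).
have xA : x *m A = a *: x - b *: y.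
  apply/matrixP => i j; move/matrixP/(_ i j): vA; rewrite !mxE.
  move=> /(congr1 (@complex.Re R)); rewrite raddf_sum /= vE.
  rewrite /= !mxE => <-; apply: eq_bigr => k _.
  by rewrite !mxE vE /=; case: (v i k) => p q /=; rewrite !mxE; ring.
have yA : y *m A = a *: y + b *: x.
  apply/matrixP => i j; move/matrixP/(_ i j): vA; rewrite !mxE.
  move=> /(congr1 (@complex.Im R)); rewrite raddf_sum /= vE.
  rewrite /= !mxE => <-; apply: eq_bigr => k _.
  by rewrite !mxE vE /=; case: (v i k) => p q /=; rewrite !mxE; ring.
have imz : b = 0.
  have : frob (x *m A) y = frob (y *m A) x by rewrite frob_mulr symA frobC.
  rewrite xA yA !(frobBl, frobDl, frobZl) (frobC y x) => h.
  have /eqP : b * (frob x x + frob y y) = 0 by lra.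
  rewrite mulf_eq0 => /orP [/eqP //|]; rewrite paddr_eq0 ?frob_ge0 // !frob_eq0.
  case/andP=> /eqP x0 /eqP y0; case/eqP: v0.
  by apply/matrixP => i j; rewrite vE x0 y0 !mxE.
exists (a).
rewrite imz !scale0r subr0 in xA; rewrite imz scale0r addr0 in yA.
have [x0|x0] := eqVneq x 0; last by apply/eigenvalueP; exists x.
apply/eigenvalueP; exists y => //; apply: contraNneq v0 => y0.
by apply/eqP/matrixP => i j; rewrite vE x0 y0 !mxE.
Qed.

(** * Spectral theorem and traces of powers *)

(** Reflection in the hyperplane orthogonal to e - v, which exchanges the two unit vectors; it is
    used to move an eigenvector to the first coordinate. *)
Lemma householder (R : realType) (n : nat) (v : 'rV[R]_n.+1) :
  frob v v = 1 ->
  exists H : 'M[R]_n.+1, [/\ H^T = H, H *m H = 1%:M & delta_mx 0 0 *m H = v].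
Proof.
move=> v1; pose e : 'rV[R]_n.+1 := delta_mx 0 0.
have fe (u : 'rV[R]_n.+1) : frob e u = u 0 0.
  rewrite /frob big_ord_recl big_ord0 addr0 big_ord_recl big1 => [|i _].
    by rewrite addr0 /e mxE eqxx mul1r.
  by rewrite mxE /= mul0r.
have [ve|ve] := eqVneq v e; first by exists 1%:M; rewrite trmx1 !mulmx1 ve.
pose w := e - v; have wE : w = e - v by []; clearbody w.
have w0 : frob w w != 0 by rewrite frob_eq0 wE subr_eq0 eq_sym.
have ww : w *m w^T = (frob w w)%:M.
  by rewrite [LHS]mx11_scalar frobE mxtrace_mulC trace_mx11.
have ew : e *m w^T = (frob e w)%:M.
  by rewrite [LHS]mx11_scalar frobC frobE mxtrace_mulC trace_mx11.
exists (1%:M - (2 / frob w w) *: (w^T *m w)); split.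
- by rewrite raddfB /= linearZ /= trmx1 trmx_mul trmxK.
- rewrite !(mulmxBl, mulmxBr) !(mulmx1, mul1mx) -scalemxAl -scalemxAr.
  rewrite -(mulmxA w^T) (mulmxA w w^T) ww mul_scalar_mx -scalemxAr.
  move: (w^T *m w) => M; apply/matrixP => i j; rewrite !mxE.
  by move: (_ == _)%:R => d; field.
rewrite -/e mulmxBr mulmx1 -scalemxAr mulmxA ew mul_scalar_mx scalerA.
have -> : 2 / frob w w * frob e w = 1.
  have -> : frob w w = 2 * frob e w.
    rewrite wE !(frobBl, frobBr) v1 (frobC v) !fe /e mxE eqxx /=; ring.
  field; move: w0.
  have -> : frob w w = 2 * frob e w.
    rewrite wE !(frobBl, frobBr) v1 (frobC v) !fe /e mxE eqxx /=; ring.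
  by rewrite mulf_eq0 negb_or => /andP [_ ->].
by rewrite scale1r wE subKr.
Qed.

(** Deflation: after a reflection the first row of A is a multiple of the first basis vector,
    symmetry clears the first column too, and the lower right block is again symmetric. *)
Lemma spectral_theorem (R : realType) (n : nat) (A : 'M[R]_n) : A^T = A ->
  exists (V : 'M[R]_n) (l : 'rV[R]_n),
    V *m V^T = 1%:M /\ A = V^T *m diag_mx l *m V.
Proof.
elim: n A => [|n IH] A symA.
  by exists 0, 0; split; apply/matrixP => -[].
have [a /eigenvalueP [v vA v0]] := sym_has_eigenvalue symA.
have fv : 0 < frob v v by rewrite lt_neqAle frob_ge0 eq_sym frob_eq0 v0.
pose u := (Num.sqrt (frob v v))^-1 *: v.
have u1 : frob u u = 1.
  rewrite frobZl frobZr mulrA -invfM -expr2 sqr_sqrtr ?ltW // mulVf //.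
  by rewrite gt_eqF.
have uA : u *m A = a *: u by rewrite -scalemxAl vA scalerA mulrC -scalerA.
have [H [HT HH eH]] := householder u1.
have uH : u *m H = delta_mx 0 0 by rewrite -eH -mulmxA HH mulmx1.
pose B : 'M[R]_(1 + n) := H *m A *m H.
have symB : B^T = B by rewrite /B !trmx_mul HT symA mulmxA.
have eB : usubmx B = a *: delta_mx 0 0.
  have -> : usubmx B = delta_mx 0 0 *m B.
    by rewrite -rowE; apply/matrixP => i j; rewrite !mxE; have -> : lshift n i = 0 :> 'I_n.+1 by apply/val_inj; rewrite /= ord1.
  by rewrite /B !mulmxA eH uA -scalemxAl uH.
have ulB : ulsubmx B = a%:M.
  by rewrite /ulsubmx eB; apply/matrixP => i j; rewrite !ord1 !mxE /= mulr1.
have urB : ursubmx B = 0.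
  by rewrite /ursubmx eB; apply/matrixP => i j; rewrite !mxE andbF mulr0.
have dlB : dlsubmx B = 0.
  by rewrite -[B]symB -trmx_ursub urB trmx0.
have symD : (drsubmx B)^T = drsubmx B by rewrite trmx_drsub symB.
have [V [l [VV DE]]] := IH _ symD.
pose W : 'M[R]_(1 + n) := block_mx 1%:M 0 0 V.
pose d : 'rV[R]_(1 + n) := row_mx a%:M l.
have WT : W^T = block_mx 1%:M 0 0 V^T by rewrite /W tr_block_mx !trmx0 trmx1.
have WW : W *m W^T = 1%:M.
  rewrite WT mulmx_block !(mulmx0, mul0mx, mulmx1, addr0, add0r) VV.
  by rewrite [RHS]scalar_mx_block.
have BE : B = W^T *m diag_mx d *m W.
  rewrite WT /d diag_mx_row.
  have -> : diag_mx (a%:M : 'M[R]_1) = a%:M.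
    by apply/matrixP => i j; rewrite !ord1 !mxE !eqxx.
  rewrite /W !mulmx_block !(mulmx0, mul0mx, mulmx1, mul1mx, addr0, add0r) -DE.
  by rewrite -[LHS]submxK ulB urB dlB.
exists (W *m (H : 'M[R]_(1 + n))), d; split.
  by rewrite trmx_mul HT mulmxA -(mulmxA W) HH mulmx1.
rewrite trmx_mul HT -!mulmxA (mulmxA W^T) (mulmxA (W^T *m _)) -BE.
by rewrite /B !mulmxA HH mul1mx -mulmxA HH mulmx1.
Qed.

(** * Positive semidefinite matrices and trace inequalities *)

Definition psd (R : realType) (n : nat) (A : 'M[R]_n) : Prop :=
  A^T = A /\ forall u : 'cV[R]_n, 0 <= frob u (A *m u).

Lemma exprS_mulmx (R : realType) (n : nat) (A : 'M[R]_n) (k : nat) :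
  A ^+ k.+1 = A *m A ^+ k.
Proof. exact: exprS. Qed.

Lemma expr0_mulmx (R : realType) (n : nat) (A : 'M[R]_n) : A ^+ 0 = 1%:M.
Proof. exact: expr0. Qed.

Lemma spectral_exp (R : realType) (n : nat) (V : 'M[R]_n) (l : 'rV[R]_n) (k : nat) :
  V *m V^T = 1%:M ->
  (V^T *m diag_mx l *m V) ^+ k = V^T *m diag_mx (\row_j l 0 j ^+ k) *m V.
Proof.
move=> VV; elim: k => [|k IH].
  have -> : diag_mx (\row_j l 0 j ^+ 0) = 1%:M.
    by apply/matrixP => i j; rewrite !mxE expr0.
  by rewrite mulmx1 (mulmx1C VV).
rewrite exprS_mulmx IH !mulmxA -(mulmxA _ V) VV mulmx1 -(mulmxA V^T) mulmx_diag.
by congr (_ *m diag_mx _ *m _); apply/rowP => j; rewrite !mxE exprS.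
Qed.

Lemma frob_delta (R : realType) (m n : nat) (i : 'I_m) (j : 'I_n) (A : 'M[R]_(m, n)) :
  frob (delta_mx i j) A = A i j.
Proof.
rewrite /frob (bigD1 i) //= (bigD1 j) //= !mxE !eqxx mul1r !big1 ?addr0 //.
  by move=> k /negbTE ki; apply: big1 => l _; rewrite mxE ki mul0r.
by move=> k /negbTE kj; rewrite mxE kj andbF mul0r.
Qed.

Lemma spectral_psd (R : realType) (n : nat) (V : 'M[R]_n) (l : 'rV[R]_n) i :
  V *m V^T = 1%:M -> psd (V^T *m diag_mx l *m V) -> 0 <= l 0 i.
Proof.
move=> VV [_ /(_ (V^T *m delta_mx i 0))].
rewrite !mulmxA -(mulmxA _ V) VV mulmx1 -mulmxA frob_mull trmxK mulmxA VV mul1mx.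
suff -> : frob (delta_mx i 0) (diag_mx l *m delta_mx i 0 : 'cV_n) = l 0 i by [].
by rewrite frob_delta mul_diag_mx !mxE !eqxx mulr1.
Qed.

(* With eigenvectors [u_i] of A and [v_j] of B, [w i j = <u_i, v_j>^2]: traces of
   products of powers of two symmetric matrices behave like moments of a pair of
   real random variables. *)
Lemma trace_pair (R : realType) (n : nat) (A B : 'M[R]_n) :
  A^T = A -> B^T = B ->
  exists (a b : 'I_n -> R) (w : 'I_n -> 'I_n -> R),
    [/\ forall i j, 0 <= w i j,
        forall k l, \tr (A ^+ k *m B ^+ l) =
          \sum_i \sum_j w i j * (a i ^+ k * b j ^+ l),
        psd A -> forall i, 0 <= a i
      & psd B -> forall j, 0 <= b j].
Proof.
move=> /spectral_theorem [V [a [VV AE]]] /spectral_theorem [U [b [UU BE]]].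
pose W := V *m U^T.
exists (fun i => a 0 i), (fun j => b 0 j), (fun i j => W i j ^+ 2); split.
- by move=> i j; exact: sqr_ge0.
- move=> k l; rewrite AE BE !spectral_exp // -!mulmxA mxtrace_mulC -!mulmxA.
  have WT : U *m V^T = W^T by rewrite trmx_mul trmxK.
  rewrite WT (mulmxA V) -/W mulmxA !mul_diag_mx /mxtrace.
  apply: eq_bigr => i _; rewrite mxE; apply: eq_bigr => j _.
  by rewrite !mxE; ring.
- by move=> pA i; apply: spectral_psd VV _; rewrite -AE.
- by move=> pB i; apply: spectral_psd UU _; rewrite -BE.
Qed.

Lemma even_expr_ge0 (R : realType) (x : R) (k : nat) : ~~ odd k -> 0 <= x ^+ k.
Proof. by move=> /even_halfK <-; rewrite -muln2 exprM sqr_ge0. Qed.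

Lemma trace_psd_exp_ge0 (R : realType) (n : nat) (M B : 'M[R]_n) (k : nat) :
  psd M -> B^T = B -> (psd B \/ ~~ odd k) -> 0 <= \tr (M *m B ^+ k).
Proof.
move=> pM sB h; have [a [b [w [w0 tE a0 b0]]]] := trace_pair (proj1 pM) sB.
rewrite -[M]expr1 tE; apply: sumr_ge0 => i _; apply: sumr_ge0 => j _.
apply: mulr_ge0 => //; apply: mulr_ge0; first by rewrite expr1 a0.
by case: h => [/b0 h|]; [rewrite exprn_ge0|exact: even_expr_ge0].
Qed.

(** Multiplying the inequality for p by a and adding (p+1) b^p (b - a)^2 >= 0 gives the one for
    p+1. *)
Lemma young_expr (R : realType) (a b : R) (p : nat) : 0 <= a -> 0 <= b ->
  p.+1%:R * (a * b ^+ p) <= a ^+ p.+1 + p%:R * b ^+ p.+1.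
Proof.
move=> a0 b0; elim: p => [|p IH]; first by rewrite !expr0 !expr1; lra.
have := mulr_ge0 (ler0n R p.+1) (mulr_ge0 (exprn_ge0 p b0) (sqr_ge0 (b - a))).
have := ler_wpM2l a0 IH; rewrite -!(natr1 p.+1) -(natr1 p) !exprS expr0.
move: (p%:R) (a ^+ p) (b ^+ p) => P x y; nra.
Qed.

Lemma trace_young (R : realType) (n : nat) (A B : 'M[R]_n) (p : nat) :
  psd A -> psd B ->
  p.+1%:R * \tr (A *m B ^+ p) <= \tr (A ^+ p.+1) + p%:R * \tr (B ^+ p.+1).
Proof.
move=> pA pB; have [a [b [w [w0 tE a0 b0]]]] := trace_pair (proj1 pA) (proj1 pB).
have -> : A ^+ p.+1 = A ^+ p.+1 *m B ^+ 0 by rewrite expr0_mulmx mulmx1.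
have -> : B ^+ p.+1 = A ^+ 0 *m B ^+ p.+1 by rewrite expr0_mulmx mul1mx.
rewrite -[A in A *m _]expr1 !tE !mulr_sumr -big_split; apply: ler_sum => i _ /=.
rewrite !mulr_sumr -big_split; apply: ler_sum => j _ /=.
rewrite mulrCA [p%:R * _]mulrCA -mulrDr ler_wpM2l //.
by rewrite !expr0 mulr1 mul1r expr1; apply: young_expr; [exact: a0|exact: b0].
Qed.

(** For nonnegative a and b the difference is (a^i - b^i)(a^j - b^j), whose factors have the same
    sign. An even total degree reduces the general case to absolute values. *)
Lemma mixed_expr_le (R : realType) (a b : R) (i j : nat) :
  ~~ odd (i + j) \/ (0 <= a /\ 0 <= b) ->
  a ^+ i * b ^+ j + a ^+ j * b ^+ i <= a ^+ (i + j) + b ^+ (i + j).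
Proof.
move=> h.
have pos (x y : R) : 0 <= x -> 0 <= y ->
    x ^+ i * y ^+ j + x ^+ j * y ^+ i <= x ^+ (i + j) + y ^+ (i + j).
  move=> x0 y0; rewrite !exprD.
  suff : 0 <= (x ^+ i - y ^+ i) * (x ^+ j - y ^+ j) by lra.
  have [xy|/ltW xy] := leP x y.
    by rewrite mulr_le0 // subr_le0 lerXn2r.
  by rewrite mulr_ge0 // subr_ge0 lerXn2r.
case: h => [ev|[]]; last exact: pos.
have := pos _ _ (normr_ge0 a) (normr_ge0 b).
rewrite -!normrX !(ger0_norm (even_expr_ge0 _ ev)); apply: le_trans.
by apply: lerD; rewrite -normrM ler_norm.
Qed.

(** Factoring a^(q+1) - b^(q+1) leaves (a - b)^2 times the sum of the a^i b^(q-i). Pairing each term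
    with its mirror image makes [mixed_expr_le] applicable q+1 times. *)
Lemma exchange_expr (R : realType) (a b : R) (q : nat) :
  ~~ odd q \/ (0 <= a /\ 0 <= b) ->
  (a - b) * (a ^+ q.+1 - b ^+ q.+1) <=
  q.+1%:R / 2 * ((a - b) ^+ 2 * (a ^+ q + b ^+ q)).
Proof.
move=> h; rewrite subrXX mulrA -expr2 mulrCA ler_wpM2l ?sqr_ge0 //.
set s := \sum_(i < _) _.
have sE : s = \sum_(i < q.+1) a ^+ i * b ^+ (q - i).
  rewrite /s (reindex_inj rev_ord_inj) /=; apply: eq_bigr => i _.
  by rewrite subSS subKn // -ltnS.
suff : s + s <= q.+1%:R * (a ^+ q + b ^+ q) by lra.
rewrite {1}/s sE -big_split /= mulr_natl -[q.+1 in leRHS]card_ord -sumr_const.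
apply: ler_sum => i _.
have iq : (q - i + i = q)%N by rewrite subnK // -ltnS.
by have := @mixed_expr_le _ a b (q - i) i; rewrite iq; apply.
Qed.

(** By [trace_pair] both sides are double sums over eigenvalues with the same nonnegative weights,
    so the scalar inequality applies term by term, although A and B need not commute. *)
Lemma trace_exchange (R : realType) (n : nat) (A B : 'M[R]_n) (q : nat) :
  A^T = A -> B^T = B -> ~~ odd q \/ (psd A /\ psd B) ->
  \tr ((A - B) *m (A ^+ q.+1 - B ^+ q.+1)) <=
  q.+1%:R / 2 * \tr ((A - B) *m (A - B) *m (A ^+ q + B ^+ q)).
Proof.
move=> sA sB h; have [a [b [w [w0 tE a0 b0]]]] := trace_pair sA sB.
have Ak k : \tr (A ^+ k) = \sum_i \sum_j w i j * a i ^+ k.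
  rewrite -[A ^+ k]mulmx1 -(expr0_mulmx B) tE.
  by apply: eq_bigr => i _; apply: eq_bigr => j _; rewrite expr0 mulr1.
have Bk k : \tr (B ^+ k) = \sum_i \sum_j w i j * b j ^+ k.
  rewrite -[B ^+ k]mul1mx -(expr0_mulmx A) tE.
  by apply: eq_bigr => i _; apply: eq_bigr => j _; rewrite expr0 mul1r.
have -> : \tr ((A - B) *m (A ^+ q.+1 - B ^+ q.+1)) =
    \sum_i \sum_j w i j * ((a i - b j) * (a i ^+ q.+1 - b j ^+ q.+1)).
  have -> : (A - B) *m (A ^+ q.+1 - B ^+ q.+1) =
    A ^+ q.+2 - A ^+ 1 *m B ^+ q.+1 - B *m A ^+ q.+1 + B ^+ q.+2.
    by rewrite mulmxBl !mulmxBr -!exprS_mulmx expr1 opprB addrA addrAC.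
  rewrite !(mxtraceD, raddfN) /= (mxtrace_mulC B).
  rewrite -[X in A ^+ q.+1 *m X]expr1 !tE Ak Bk -!sumrN -!big_split /=.
  apply: eq_bigr => i _; rewrite -!sumrN -!big_split /=.
  by apply: eq_bigr => j _; rewrite !exprS; ring.
have -> : \tr ((A - B) *m (A - B) *m (A ^+ q + B ^+ q)) =
    \sum_i \sum_j w i j * ((a i - b j) ^+ 2 * (a i ^+ q + b j ^+ q)).
  have -> : \tr ((A - B) *m (A - B) *m (A ^+ q + B ^+ q)) =
    \tr (A ^+ q.+2) - \tr (A ^+ q.+1 *m B ^+ 1) *+ 2 + \tr (A ^+ q *m B ^+ 2)
    + \tr (A ^+ 2 *m B ^+ q) - \tr (A ^+ 1 *m B ^+ q.+1) *+ 2 + \tr (B ^+ q.+2).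
    rewrite mulmxDr mxtraceD !(mulmxBl, mulmxBr) !raddfB /=.
    rewrite !expr1.
    have c1 : \tr (A *m A *m A ^+ q) = \tr (A ^+ q.+2).
      by rewrite !exprS_mulmx mulmxA.
    have c2 : \tr (B *m B *m B ^+ q) = \tr (B ^+ q.+2).
      by rewrite !exprS_mulmx mulmxA.
    have c3 : \tr (A *m B *m A ^+ q) = \tr (A ^+ q.+1 *m B).
      by rewrite mxtrace_mulC mulmxA; congr (\tr (_ *m _)); symmetry; exact: exprSr.
    have c4 : \tr (B *m A *m A ^+ q) = \tr (A ^+ q.+1 *m B).
      by rewrite -mulmxA mxtrace_mulC exprS_mulmx.
    have c5 : \tr (B *m B *m A ^+ q) = \tr (A ^+ q *m B ^+ 2).
      by rewrite mxtrace_mulC exprS_mulmx expr1.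
    have c6 : \tr (A *m A *m B ^+ q) = \tr (A ^+ 2 *m B ^+ q).
      by rewrite exprS_mulmx expr1.
    have c7 : \tr (A *m B *m B ^+ q) = \tr (A *m B ^+ q.+1).
      by rewrite -mulmxA exprS_mulmx.
    have c8 : \tr (B *m A *m B ^+ q) = \tr (A *m B ^+ q.+1).
      rewrite -mulmxA mxtrace_mulC -mulmxA; congr (\tr (_ *m _)); symmetry; exact: exprSr.
    rewrite c1 c2 c3 c4 c5 c6 c7 c8; ring.
  rewrite !tE Ak Bk -!sumrMnl -!sumrN -!big_split /=.
  apply: eq_bigr => i _; rewrite -!sumrMnl -!sumrN -!big_split /=.
  by apply: eq_bigr => j _; rewrite !exprS; ring.
rewrite mulr_sumr; apply: ler_sum => i _; rewrite mulr_sumr; apply: ler_sum => j _.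
rewrite [leRHS]mulrCA ler_wpM2l //; apply: exchange_expr.
by case: h => [|[/a0 ? /b0 ?]]; [left|right].
Qed.

(** * Concentration for sums of random symmetric matrices *)

Lemma psdD (R : realType) (n : nat) (A B : 'M[R]_n) : psd A -> psd B -> psd (A + B).
Proof.
move=> [sA pA] [sB pB]; split=> [|u]; first by rewrite raddfD /= sA sB.
by rewrite mulmxDl frobDr addr_ge0.
Qed.

Lemma psdZ (R : realType) (n : nat) (c : R) (A : 'M[R]_n) :
  0 <= c -> psd A -> psd (c *: A).
Proof.
move=> c0 [sA pA]; split=> [|u]; first by rewrite linearZ /= sA.
by rewrite -scalemxAl frobZr mulr_ge0.
Qed.

Lemma psd0 (R : realType) (n : nat) : psd (0 : 'M[R]_n).
Proof. by split=> [|u]; rewrite ?trmx0 // mul0mx frob0r. Qed.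

Lemma psd_scalar (R : realType) (n : nat) (c : R) : 0 <= c -> psd (c%:M : 'M[R]_n).
Proof.
move=> c0; split=> [|u]; first by rewrite tr_scalar_mx.
by rewrite mul_scalar_mx frobZr mulr_ge0 // frob_ge0.
Qed.

Lemma psd_sqr (R : realType) (n : nat) (A : 'M[R]_n) : A^T = A -> psd (A *m A).
Proof.
move=> sA; split=> [|u]; first by rewrite trmx_mul sA.
by rewrite -mulmxA -{1}sA -frob_mull frob_ge0.
Qed.

Lemma psd_sum (R : realType) (n : nat) (I : finType) (F : I -> 'M[R]_n) :
  (forall i, psd (F i)) -> psd (\sum_i F i).
Proof. by move=> pF; apply: big_ind => //; [exact: psd0|exact: psdD]. Qed.

Lemma frob_sqr_sym (R : realType) (n : nat) (A : 'M[R]_n) (u : 'cV[R]_n) :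
  A^T = A -> frob u (A *m A *m u) = frob (A *m u) (A *m u).
Proof. by move=> sA; rewrite frob_mull sA mulmxA. Qed.

(** * Uniform averages, independent draws and exchangeable pairs *)

Definition avg (R : realType) (I : finType) (f : I -> R) : R :=
  (\sum_i f i) / #|I|%:R.

Lemma avgD (R : realType) (I : finType) (f g : I -> R) :
  avg (fun i => f i + g i) = avg f + avg g.
Proof. by rewrite /avg big_split mulrDl. Qed.

Lemma avgN (R : realType) (I : finType) (f : I -> R) :
  avg (fun i => - f i) = - avg f.
Proof. by rewrite /avg sumrN mulNr. Qed.

Lemma avgB (R : realType) (I : finType) (f g : I -> R) :
  avg (fun i => f i - g i) = avg f - avg g.
Proof. by rewrite avgD avgN. Qed.

Lemma avgZ (R : realType) (I : finType) (c : R) (f : I -> R) :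
  avg (fun i => c * f i) = c * avg f.
Proof. by rewrite /avg -mulr_sumr mulrA. Qed.

Lemma avg_sum (R : realType) (I J : finType) (f : I -> J -> R) :
  avg (fun i => \sum_j f i j) = \sum_j avg (fun i => f i j).
Proof. by rewrite /avg exchange_big mulr_suml. Qed.

Lemma avgC (R : realType) (I J : finType) (f : I -> J -> R) :
  avg (fun i => avg (f i)) = avg (fun j => avg (f^~ j)).
Proof.
by rewrite /avg -!mulr_suml exchange_big /= mulrAC.
Qed.

Lemma avg_le (R : realType) (I : finType) (f g : I -> R) :
  (forall i, f i <= g i) -> avg f <= avg g.
Proof. by move=> fg; rewrite ler_wpM2r ?invr_ge0 // ler_sum. Qed.

Lemma eq_avg (R : realType) (I : finType) (f g : I -> R) : f =1 g -> avg f = avg g.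
Proof. by move=> fg; rewrite /avg (eq_bigr g). Qed.

Lemma avg_cst (R : realType) (I : finType) (c : R) : (0 < #|I|)%N ->
  avg (fun _ : I => c) = c.
Proof.
by move=> I0; rewrite /avg sumr_const -[X in X / _]mulr_natr mulfK // pnatr_eq0 -lt0n.
Qed.

Definition resample (T : finType) (K : nat) (w : {ffun 'I_K -> T}) (k : 'I_K) (a : T) :
  {ffun 'I_K -> T} := [ffun j => if j == k then a else w j].

(** Swapping the k-th draw with the independent value a is an involution of the pairs (w, a), hence
    preserves their uniform law. *)
Lemma resample_exchange (R : realType) (T : finType) (K : nat) (k : 'I_K)
    (F : {ffun 'I_K -> T} -> T -> R) :
  avg (fun w => avg (F w)) = avg (fun w => avg (fun a => F (resample w k a) (w k))).
Proof.
rewrite /avg -!mulr_suml !pair_bigA /=; congr (_ / _ / _).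
pose h (p : {ffun 'I_K -> T} * T) := (resample p.1 k p.2, p.1 k).
have hK : involutive h.
  move=> [w a]; rewrite /h /=; congr (_, _); last by rewrite ffunE eqxx.
  by apply/ffunP => j; rewrite !ffunE; case: eqP => [->|].
by rewrite (reindex_inj (inv_inj hK)).
Qed.

Lemma avg_coord (R : realType) (T : finType) (K : nat) (k : 'I_K) (f : T -> R) :
  (0 < #|T|)%N -> avg (fun w : {ffun 'I_K -> T} => f (w k)) = avg f.
Proof.
move=> T0.
have W0 : (0 < #|{ffun 'I_K -> T}|)%N by rewrite card_ffun expn_gt0 T0.
rewrite -[RHS](avg_cst _ W0) [RHS](@resample_exchange _ _ _ k (fun _ => f)).
by apply: eq_avg => w; rewrite avg_cst.
Qed.

Definition draw_sum (R : realType) (T : finType) (K n : nat) (x : T -> 'M[R]_n)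
  (w : {ffun 'I_K -> T}) : 'M[R]_n := \sum_k x (w k).

Lemma draw_sum_resample (R : realType) (T : finType) (K n : nat) (x : T -> 'M[R]_n)
    (w : {ffun 'I_K -> T}) k a :
  draw_sum x w - draw_sum x (resample w k a) = x (w k) - x a.
Proof.
rewrite /draw_sum -sumrB (bigD1 k) //= ffunE eqxx big1 ?addr0 // => j /negbTE jk.
by rewrite ffunE jk subrr.
Qed.

Lemma draw_sum_sym (R : realType) (T : finType) (K n : nat) (x : T -> 'M[R]_n)
    (w : {ffun 'I_K -> T}) :
  (forall a, (x a)^T = x a) -> (draw_sum x w)^T = draw_sum x w.
Proof. by move=> sx; rewrite /draw_sum raddf_sum; apply: eq_bigr => k _ /=. Qed.

(* Exchangeable pairs: [w] and its copy with the k-th draw resampled. *)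
Lemma moment_exchange (R : realType) (T : finType) (K n q : nat) (x : T -> 'M[R]_n) k :
  (0 < #|T|)%N -> (forall a, (x a)^T = x a) ->
  ~~ odd q \/ (forall a, psd (x a)) ->
  avg (fun w : {ffun 'I_K -> T} => \tr (x (w k) *m draw_sum x w ^+ q.+1)) <=
  q.+1%:R / 2 * avg (fun w : {ffun 'I_K -> T} => avg (fun a =>
     \tr ((x (w k) - x a) *m (x (w k) - x a) *m draw_sum x w ^+ q)))
  + avg (fun w : {ffun 'I_K -> T} => avg (fun a => \tr (x a *m draw_sum x w ^+ q.+1))).
Proof.
move=> T0 sx h; rewrite -lerBlDr.
pose G (w : {ffun 'I_K -> T}) a := \tr ((x (w k) - x a) *m draw_sum x w ^+ q.+1).
pose H (w : {ffun 'I_K -> T}) a :=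
  \tr ((x (w k) - x a) *m (x (w k) - x a) *m draw_sum x w ^+ q).
have -> : avg (fun w : {ffun 'I_K -> T} => \tr (x (w k) *m draw_sum x w ^+ q.+1)) -
    avg (fun w : {ffun 'I_K -> T} => avg (fun a => \tr (x a *m draw_sum x w ^+ q.+1)))
    = avg (fun w => avg (G w)).
  rewrite -avgB; apply: eq_avg => w; rewrite -[X in X - _](avg_cst _ T0) -avgB.
  by apply: eq_avg => a; rewrite /G mulmxBl raddfB.
have EG := resample_exchange k G; have EH := resample_exchange k H.
(* The swap negates [x (w k) - x a] and exchanges S with S', so G averaged with its swap is half of
   the trace of (S - S')(S^(q+1) - S'^(q+1)). *)
have -> : avg (fun w => avg (G w)) = 2^-1 * (avg (fun w => avg (fun a =>
    G w a + G (resample w k a) (w k)))).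
  under [in RHS]eq_avg do rewrite avgD.
  by rewrite avgD -EG; field.
have -> : avg (fun w => avg (H w)) = 2^-1 * (avg (fun w => avg (fun a =>
    H w a + H (resample w k a) (w k)))).
  under [in RHS]eq_avg do rewrite avgD.
  by rewrite avgD -EH; field.
rewrite [leRHS]mulrCA ler_wpM2l // -avgZ; apply: avg_le => w.
rewrite -avgZ; apply: avg_le => a.
pose S := draw_sum x w; pose S' := draw_sum x (resample w k a).
have SS : S - S' = x (w k) - x a by rewrite draw_sum_resample.
have rk : resample w k a k = a by rewrite ffunE eqxx.
have := @trace_exchange _ _ S S' q (draw_sum_sym _ sx) (draw_sum_sym _ sx).
rewrite SS /G /H rk -/S -/S' -[x a - x (w k)]opprB !(mulNmx, mulmxN) opprK.
rewrite mulmxBr raddfB /= mulmxDr mxtraceD raddfN /=; apply.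
by case: h => [|px]; [left|right; split; apply: psd_sum].
Qed.

Definition mxavg (R : realType) (I : finType) (n : nat) (x : I -> 'M[R]_n) : 'M[R]_n :=
  (#|I|%:R)^-1 *: \sum_i x i.

Lemma avg_trace_mull (R : realType) (I : finType) (n : nat) (x : I -> 'M[R]_n) M :
  avg (fun i => \tr (x i *m M)) = \tr (mxavg x *m M).
Proof.
by rewrite /avg /mxavg -scalemxAl mxtraceZ mulmx_suml raddf_sum mulrC.
Qed.

Lemma trace_psd_exp_le (R : realType) (n : nat) (A B S : 'M[R]_n) (k : nat) :
  psd (B - A) -> S^T = S -> psd S \/ ~~ odd k -> \tr (A *m S ^+ k) <= \tr (B *m S ^+ k).
Proof.
by move=> pBA sS h; rewrite -subr_ge0 -raddfB -mulmxBl trace_psd_exp_ge0.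
Qed.

Lemma sum_trace_draw (R : realType) (T : finType) (K n : nat) (x : T -> 'M[R]_n)
    (w : {ffun 'I_K -> T}) (M : 'M[R]_n) :
  \sum_k \tr (x (w k) *m M) = \tr (draw_sum x w *m M).
Proof. by rewrite /draw_sum mulmx_suml raddf_sum. Qed.

(** Since (A - B)^2 = 2A^2 + 2B^2 - (A + B)^2, the bounds A^2 <= bA and B^2 <= bB turn the square of
    a difference into a linear expression. *)
Lemma psd_sqr_diff (R : realType) (n : nat) (b : R) (A B : 'M[R]_n) :
  psd (b *: A - A *m A) -> psd (b *: B - B *m B) -> A^T = A -> B^T = B ->
  psd ((2 * b) *: (A + B) - (A - B) *m (A - B)).
Proof.
move=> pA pB sA sB.
have -> : (2 * b) *: (A + B) - (A - B) *m (A - B) =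
    2 *: ((b *: A - A *m A) + (b *: B - B *m B)) + (A + B) *m (A + B).
  rewrite !(mulmxBl, mulmxBr, mulmxDl, mulmxDr).
  move: (A *m A) (A *m B) (B *m A) (B *m B) => AA AB BA BB.
  by apply/matrixP => i j; rewrite !mxE; ring.
apply: psdD; first by apply: psdZ => //; exact: psdD.
by apply: psd_sqr; rewrite raddfD /= sA sB.
Qed.

(** Meant for the quadratic variation, where y is the square of the original summand. The exchange
    bound, with squares of differences made linear by [psd_sqr_diff], yields a recurrence of order
    two for the trace moments. *)
Lemma psd_moment (R : realType) (T : finType) (K n p : nat) (y : T -> 'M[R]_n) (b v : R) :
  (0 < #|T|)%N -> 0 <= b -> 0 <= v ->
  (forall a, psd (y a)) -> (forall a, psd (b *: y a - y a *m y a)) ->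
  psd (v%:M - mxavg y) ->
  avg (fun w : {ffun 'I_K -> T} => \tr (draw_sum y w ^+ p)) <=
  n%:R * (2 * (K%:R * v + p%:R * b)) ^+ p.
Proof.
move=> T0 b0 v0 py hb hv.
set M := 2 * _; pose m q := avg (fun w : {ffun 'I_K -> T} => \tr (draw_sum y w ^+ q)).
have sy a : (y a)^T = y a by case: (py a).
have pD (w : {ffun 'I_K -> T}) : psd (draw_sum y w) by apply: psd_sum.
have W0 : (0 < #|{ffun 'I_K -> T}|)%N by rewrite card_ffun expn_gt0 T0.
have m_ge0 q : 0 <= m q.
  rewrite -(@avg_cst R {ffun 'I_K -> T} 0) //; apply: avg_le => w.
  by rewrite -[X in \tr X]mul1mx trace_psd_exp_ge0 //; [exact: psd_scalar|case: (pD w)|left].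
have Kv0 : 0 <= K%:R * v by rewrite mulr_ge0.
have pb0 : 0 <= p%:R * b by rewrite mulr_ge0.
have M0 : 0 <= M by rewrite /M; lra.
have mean q : avg (fun w : {ffun 'I_K -> T} => avg (fun a => \tr (y a *m draw_sum y w ^+ q))) <=
    v * m q.
  rewrite /m -avgZ; apply: avg_le => w; rewrite avg_trace_mull -mxtraceZ -mul_scalar_mx.
  by apply: trace_psd_exp_le => //; [case: (pD w)|left].
have step q : m q.+2 <= (q.+1%:R * b + K%:R * v) * m q.+1 + q.+1%:R * b * (K%:R * v) * m q.
  have ex k : avg (fun w : {ffun 'I_K -> T} => \tr (y (w k) *m draw_sum y w ^+ q.+1)) <=
      q.+1%:R * b * (avg (fun w : {ffun 'I_K -> T} => \tr (y (w k) *m draw_sum y w ^+ q)) + v * m q)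
      + v * m q.+1.
    apply: (le_trans (moment_exchange k T0 sy (or_intror py))).
    apply: lerD => //.
    have -> (c : R) : q.+1%:R * b * c = q.+1%:R / 2 * (2 * b * c) by field.
    rewrite ler_wpM2l // ?divr_ge0 //.
    apply: (@le_trans _ _ (2 * b * avg (fun w : {ffun 'I_K -> T} =>
       \tr (y (w k) *m draw_sum y w ^+ q) + avg (fun a => \tr (y a *m draw_sum y w ^+ q))))).
      rewrite -avgZ; apply: avg_le => w.
      rewrite -[X in _ * (X + _)](avg_cst _ T0) -avgD -avgZ; apply: avg_le => a.
      rewrite -mxtraceD -mulmxDl -mxtraceZ scalemxAl.
      apply: trace_psd_exp_le; [|by case: (pD w)|by left].
      exact: psd_sqr_diff.
    rewrite avgD ler_wpM2l //; first by rewrite mulr_ge0.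
    by rewrite lerD2l.
  have -> : m q.+2 = \sum_k avg (fun w : {ffun 'I_K -> T} => \tr (y (w k) *m draw_sum y w ^+ q.+1)).
    by rewrite -avg_sum; apply: eq_avg => w; rewrite sum_trace_draw exprS_mulmx.
  apply: (le_trans (ler_sum _ (fun k _ => ex k))).
  rewrite big_split /= -mulr_sumr big_split /= !sumr_const card_ord.
  rewrite -avg_sum; under eq_avg do rewrite sum_trace_draw -exprS_mulmx.
  rewrite -/(m q.+1) -[(v * m q) *+ K]mulr_natr -[(v * m q.+1) *+ K]mulr_natr.
  by rewrite le_eqVlt; apply/orP; left; apply/eqP; ring.
have m1 : m 1%N <= n%:R * M.
  have -> : m 1%N = \sum_(k < K) avg (fun w : {ffun 'I_K -> T} => \tr (y (w k))).
    by rewrite -avg_sum; apply: eq_avg => w; rewrite expr1 /draw_sum raddf_sum.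
  under eq_bigr do rewrite (avg_coord _ (fun a => \tr (y a))) //.
  rewrite sumr_const card_ord.
  have : avg (fun a => \tr (y a)) <= n%:R * v.
    under eq_avg do rewrite -[y _]mulmx1; rewrite avg_trace_mull mulmx1.
    have := @trace_psd_exp_ge0 _ _ _ 1%:M 0 hv (trmx1 _ _) (or_intror isT).
    by rewrite expr0_mulmx mulmx1 raddfB subr_ge0 /= mxtrace_scalar mulr_natl.
  rewrite -[_ *+ K]mulr_natr => h.
  apply: (@le_trans _ _ (n%:R * v * K%:R)); first by rewrite ler_wpM2r.
  rewrite -mulrA ler_wpM2l // /M; lra.
have m0 : m 0%N = n%:R.
  by rewrite /m; under eq_avg do rewrite expr0_mulmx mxtrace1; rewrite avg_cst.
(* The recurrence looks back two steps, so two consecutive moments are carried along. With u = Kv, d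
   = pb and c = (q+1)b <= d, the value M = 2(u + d) satisfies (c + u)M + cu <= M^2, which closes the
   induction. *)
have both : forall q, (q < p)%N -> m q <= n%:R * M ^+ q /\ m q.+1 <= n%:R * M ^+ q.+1.
  elim=> [|q IH] qp; first by rewrite expr0 expr1 m0 mulr1.
  have [h1 h2] := IH (ltnW qp); split=> //.
  apply: (le_trans (step q)).
  have qb : q.+1%:R * b <= p%:R * b by rewrite ler_wpM2r // ler_nat ltnW.
  have qb0 : 0 <= q.+1%:R * b by rewrite mulr_ge0.
  apply: (@le_trans _ _ (n%:R * M ^+ q * ((q.+1%:R * b + K%:R * v) * M
       + q.+1%:R * b * (K%:R * v)))).
    rewrite [leRHS]mulrDr; apply: lerD.
      rewrite [leRHS]mulrCA ler_wpM2l ?addr_ge0 //.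
      by rewrite -mulrA -exprSr.
    by rewrite [leRHS]mulrC ler_wpM2l // mulr_ge0.
  rewrite 2!exprSr -(mulrA _ M M) [leRHS]mulrA ler_wpM2l ?mulr_ge0 ?exprn_ge0 //.
  move: qb qb0 Kv0 pb0; rewrite /M; set c := q.+1%:R * b; set d := p%:R * b; set u := K%:R * v.
  move=> cd c0 u0 d0.
  have dc : 0 <= d - c by rewrite subr_ge0.
  have := mulr_ge0 dc (addr_ge0 u0 d0); have := mulr_ge0 dc u0.
  have := mulr_ge0 u0 d0; have := sqr_ge0 u; have := sqr_ge0 d; rewrite !expr2; lra.
rewrite -/(m p); case: (posnP p) => [p0|p0]; first by rewrite p0 expr0 mulr1 m0.
by have := both p.-1; rewrite prednK // => /(_ (leqnn _)) [].
Qed.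

Lemma exp_mulmx_self (R : realType) (n : nat) (S : 'M[R]_n) (p : nat) :
  (S *m S) ^+ p = S ^+ p.*2.
Proof. by rewrite -mul2n; symmetry; exact: exprM. Qed.

Lemma sym_moment (R : realType) (T : finType) (K n p : nat) (x : T -> 'M[R]_n) (b v : R) :
  (0 < #|T|)%N -> 0 <= b -> 0 <= v ->
  (forall a, (x a)^T = x a) -> mxavg x = 0 ->
  (forall a, psd (b%:M - x a *m x a)) ->
  psd (v%:M - mxavg (fun a => x a *m x a)) ->
  avg (fun w : {ffun 'I_K -> T} => \tr (draw_sum x w ^+ (p.+1).*2)) <=
  n%:R * (4 * p.+1%:R * (K%:R * v + p.+1%:R * b)) ^+ p.+1.
Proof.
move=> T0 b0 v0 sx x0 hb hv; pose y a := x a *m x a.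
have W0 : (0 < #|{ffun 'I_K -> T}|)%N by rewrite card_ffun expn_gt0 T0.
have py a : psd (y a) by exact: psd_sqr.
(* b x^2 - x^4 = x (b - x^2) x. *)
have hy a : psd (b *: y a - y a *m y a).
  split=> [|u]; first by rewrite raddfB /= linearZ /= !trmx_mul !sx.
  have [_ /(_ (x a *m u))] := hb a.
  rewrite frob_mull sx; congr (0 <= frob _ _).
  rewrite !(mulmxBl, mulmxBr) mul_scalar_mx -scalemxAr /y -scalemxAl.
  by rewrite !mulmxA.
set s := avg _.
pose u : R := K%:R * v; set M := u + p.+1%:R * b.
have u0 : 0 <= u by rewrite mulr_ge0.
have M0 : 0 <= M by rewrite addr_ge0 // mulr_ge0.
have sS (w : {ffun 'I_K -> T}) : (draw_sum x w)^T = draw_sum x w by exact: draw_sum_sym.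
have pSS (w : {ffun 'I_K -> T}) : psd (draw_sum x w *m draw_sum x w) by exact: psd_sqr.
have ev : ~~ odd p.*2 by rewrite odd_double.
(* The moment is bounded by itself with two factors S replaced by the quadratic
   variation; Young's inequality then absorbs the remaining powers of S. *)
have recur : s <= p.*2.+1%:R / 2 * (avg (fun w : {ffun 'I_K -> T} =>
     \tr (draw_sum y w *m draw_sum x w ^+ p.*2)) +
     u * avg (fun w : {ffun 'I_K -> T} => \tr (draw_sum x w ^+ p.*2))).
  have -> : s = \sum_k avg (fun w : {ffun 'I_K -> T} => \tr (x (w k) *m draw_sum x w ^+ p.*2.+1)).
    by rewrite -avg_sum; apply: eq_avg => w; rewrite sum_trace_draw doubleS exprS_mulmx.
  have ex k : avg (fun w : {ffun 'I_K -> T} => \tr (x (w k) *m draw_sum x w ^+ p.*2.+1)) <=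
      p.*2.+1%:R / 2 * (avg (fun w : {ffun 'I_K -> T} => \tr (y (w k) *m draw_sum x w ^+ p.*2)
        + v * \tr (draw_sum x w ^+ p.*2))).
    apply: (le_trans (moment_exchange k T0 sx (or_introl ev))).
    have -> : avg (fun w : {ffun 'I_K -> T} =>
        avg (fun a => \tr (x a *m draw_sum x w ^+ p.*2.+1))) = 0.
      rewrite -[RHS](avg_cst 0 W0); apply: eq_avg => w.
      by rewrite avg_trace_mull x0 mul0mx mxtrace0.
    rewrite addr0 ler_wpM2l //; apply: avg_le => w; set S := draw_sum x w ^+ _.
    have -> : avg (fun a => \tr ((x (w k) - x a) *m (x (w k) - x a) *m S)) =
        \tr (y (w k) *m S) + \tr (mxavg y *m S).
      (* Expanding the square, the two cross terms are linear in [x a] and average to 0 because x is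
         centered. *)
      have -> : avg (fun a => \tr ((x (w k) - x a) *m (x (w k) - x a) *m S)) =
          avg (fun a => \tr (y (w k) *m S) + \tr (y a *m S)
             - \tr (x a *m (S *m x (w k))) - \tr (x a *m (x (w k) *m S))).
        apply: eq_avg => a; rewrite !(mulmxBl, mulmxBr) !raddfB /=.
        rewrite -[x (w k) *m x a *m S]mulmxA [\tr (x (w k) *m _)]mxtrace_mulC.
        rewrite -[x a *m S *m _]mulmxA -[x a *m x (w k) *m S]mulmxA /y.
        by ring.
      by rewrite 2!avgB avgD avg_cst // !avg_trace_mull x0 !mul0mx mxtrace0 !subr0.
    rewrite lerD2l -mxtraceZ -mul_scalar_mx; apply: trace_psd_exp_le => //.
    by right.
  apply: (le_trans (ler_sum _ (fun k _ => ex k))).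
  rewrite -mulr_sumr ler_wpM2l // -avg_sum /u -avgZ -avgD; apply: avg_le => w.
  by rewrite big_split /= sum_trace_draw sumr_const card_ord -[_ *+ K]mulr_natl mulrA.
have young c (A : {ffun 'I_K -> T} -> 'M[R]_n) : 0 <= c -> (forall w, psd (A w)) ->
    p.+1%:R * (c * avg (fun w => \tr (A w *m draw_sum x w ^+ p.*2))) <=
    c ^+ p.+1 * avg (fun w => \tr (A w ^+ p.+1)) + p%:R * s.
  move=> c0 pA; rewrite -!avgZ -avgD; apply: avg_le => w.
  rewrite -[draw_sum x w ^+ p.*2]exp_mulmx_self -[draw_sum x w ^+ _.*2]exp_mulmx_self.
  rewrite -mxtraceZ scalemxAl.
  apply: (le_trans (trace_young p (psdZ c0 (pA w)) (pSS w))).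
  rewrite lerD2r -mxtraceZ.
  suff -> : (c *: A w) ^+ p.+1 = c ^+ p.+1 *: A w ^+ p.+1 by [].
  elim: (p.+1) => [|q IH]; first by rewrite !expr0 scale1r.
  by rewrite !exprS_mulmx IH -scalemxAl -scalemxAr scalerA exprS.
(* Weight c in Young's inequality cancels the prefactor c/2 of [recur]: multiplied by p+1, that
   bound leaves p copies of s on the right against p+1 on the left. Hence s <= n (2cM)^(p+1), and c
   <= 2(p+1) gives the stated constant 4(p+1). *)
pose c : R := p.*2.+1%:R.
have c0 : 0 <= c by rewrite ler0n.
have Y1 := young c (draw_sum y) c0 (fun w => psd_sum (fun k => py (w k))).
have Y2 := young c (fun=> u%:M) c0 (fun=> psd_scalar _ u0).
have D := @psd_moment R T K n p.+1 y b v T0 b0 v0 py hy hv.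
have uE : avg (fun w : {ffun 'I_K -> T} => \tr ((u%:M : 'M[R]_n) ^+ p.+1)) = n%:R * u ^+ p.+1.
  rewrite avg_cst //.
  have -> : (u%:M : 'M[R]_n) ^+ p.+1 = (u ^+ p.+1)%:M.
    elim: (p.+1) => [|q IH]; first by rewrite expr0_mulmx expr0.
    by rewrite exprS_mulmx IH -scalar_mxM exprS.
  by rewrite mxtrace_scalar mulr_natl.
have uE' : avg (fun w : {ffun 'I_K -> T} => \tr (u%:M *m draw_sum x w ^+ p.*2)) =
    u * avg (fun w : {ffun 'I_K -> T} => \tr (draw_sum x w ^+ p.*2)).
  by rewrite -avgZ; apply: eq_avg => w; rewrite mul_scalar_mx mxtraceZ.
rewrite uE uE' in Y2.
have uM : n%:R * u ^+ p.+1 <= n%:R * (2 * M) ^+ p.+1.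
  rewrite ler_wpM2l // lerXn2r ?nnegrE ?mulr_ge0 //.
  have pb0 : 0 <= p.+1%:R * b by exact: mulr_ge0.
  by rewrite /M; lra.
rewrite -/u -/M in D.
have cp : 0 <= c ^+ p.+1 by rewrite exprn_ge0.
have D' := ler_wpM2l cp D; have uM' := ler_wpM2l cp uM.
have bound : s <= c ^+ p.+1 * (n%:R * (2 * M) ^+ p.+1).
  have p1 : (0 : R) <= p.+1%:R by [].
  have recur' := ler_wpM2l p1 recur; rewrite -/c in recur'.
  rewrite -natr1 in recur' Y1 Y2.
  move: recur' Y1 Y2 D' uM'.
  set e1 := avg _; set e2 := avg _; set e3 := avg _; lra.
apply: (le_trans bound); rewrite mulrCA -exprMn ler_wpM2l //.
rewrite lerXn2r ?nnegrE ?mulr_ge0 //.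
rewrite mulrA ler_wpM2r // /c -addn1 natrD -muln2 natrM -natr1; lra.
Qed.

(** * Probabilities and tail bounds *)

Definition prb (R : realType) (I : finType) (E : I -> Prop) : R :=
  avg (fun i => (`[< E i >] : nat)%:R).

Lemma prb_le (R : realType) (I : finType) (E F : I -> Prop) :
  (forall i, E i -> F i) -> prb R E <= prb R F.
Proof.
move=> EF; apply: avg_le => i; rewrite ler_nat.
by case: asboolP => // /EF Fi; case: asboolP.
Qed.

Lemma prb_or (R : realType) (I : finType) (E F : I -> Prop) :
  prb R (fun i => E i \/ F i) <= prb R E + prb R F.
Proof.
rewrite /prb -avgD; apply: avg_le => i; rewrite -natrD ler_nat.
by case: asboolP => // -[] h; [case: (asboolP (E i))|case: (asboolP (F i))] => //;
  rewrite ?addn1.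
Qed.

Lemma prb_exists (R : realType) (I J : finType) (E : J -> I -> Prop) (d : R) :
  (forall j, prb R (E j) <= d) -> prb R (fun i => exists j, E j i) <= #|J|%:R * d.
Proof.
move=> Ed; apply: (@le_trans _ _ (\sum_j prb R (E j))).
  rewrite /prb -avg_sum; apply: avg_le => i; rewrite -natr_sum ler_nat.
  case: asboolP => // -[j Eji]; rewrite (bigD1 j) //=.
  by case: asboolP.
by rewrite mulr_natl -sumr_const; apply: ler_sum => j _.
Qed.

Lemma prb_not (R : realType) (I : finType) (E : I -> Prop) : (0 < #|I|)%N ->
  prb R E = 1 - prb R (fun i => ~ E i).
Proof.
move=> I0; rewrite -(avg_cst 1 I0) -avgB; apply: eq_avg => i.
by rewrite asbool_neg; case: asbool; rewrite ?subr0 ?subrr.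
Qed.

(** If the bound fails, some eigenvalue has square above s, and its even power alone is at most the
    trace, all other terms being nonnegative. *)
Lemma spectral_large (R : realType) (n p : nat) (S : 'M[R]_n) (s : R) :
  0 <= s -> S^T = S -> ~ (forall u : 'cV[R]_n, frob (S *m u) (S *m u) <= s * frob u u) ->
  s ^+ p <= \tr (S ^+ p.*2).
Proof.
move=> s0 /spectral_theorem [V [l [VV SE]]] nb.
have [i li] : exists i, s < l 0 i ^+ 2.
  apply: contra_notP nb => /forallNP h u.
  have V1 (z : 'cV[R]_n) : frob (V^T *m z) (V^T *m z) = frob z z.
    by rewrite frob_mull trmxK mulmxA VV mul1mx.
  have uE : u = V^T *m (V *m u) by rewrite mulmxA (mulmx1C VV) mul1mx.
  rewrite SE [in leRHS]uE V1 -!mulmxA V1; move: (V *m u) => z.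
  rewrite /frob mulr_sumr; apply: ler_sum => j _; rewrite !big_ord1 mul_diag_mx !mxE.
  rewrite mulrACA -!expr2 ler_wpM2r ?sqr_ge0 //.
  by have /negP := h j; rewrite -leNgt.
rewrite SE spectral_exp // mxtrace_mulC mulmxA VV mul1mx mxtrace_diag.
rewrite (bigD1 i) //= mxE; apply: ler_wpDr.
  by apply: sumr_ge0 => j _; rewrite mxE even_expr_ge0 // odd_double.
by rewrite -mul2n exprM lerXn2r // ?nnegrE ?sqr_ge0 // ltW.
Qed.

(** Markov's inequality for the moment of order 2(p+1). The threshold s is four times the base in
    [sym_moment], so every power contributes a factor 1/4. *)
Lemma sym_tail (R : realType) (T : finType) (K n p : nat) (x : T -> 'M[R]_n) (b v s : R) :
  (0 < #|T|)%N -> 0 <= b -> 0 <= v -> 0 < s ->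
  (forall a, (x a)^T = x a) -> mxavg x = 0 ->
  (forall a, psd (b%:M - x a *m x a)) ->
  psd (v%:M - mxavg (fun a => x a *m x a)) ->
  16 * p.+1%:R * (K%:R * v + p.+1%:R * b) <= s ->
  prb R (fun w : {ffun 'I_K -> T} => ~ (forall u : 'cV[R]_n,
     frob (draw_sum x w *m u) (draw_sum x w *m u) <= s * frob u u)) <=
  n%:R * (4^-1) ^+ p.+1.
Proof.
move=> T0 b0 v0 s0 sx x0 hb hv hs.
have mom := @sym_moment R T K n p x b v T0 b0 v0 sx x0 hb hv.
have sp0 : 0 < s ^+ p.+1 by exact: exprn_gt0.
apply: (@le_trans _ _ (n%:R * (4 * p.+1%:R * (K%:R * v + p.+1%:R * b)) ^+ p.+1 / s ^+ p.+1)).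
  rewrite ler_pdivlMr //; apply: le_trans mom.
  rewrite mulrC -avgZ; apply: avg_le => w.
  case: asboolP => [nb|_].
    by rewrite mulr1; apply: spectral_large => //; [exact: ltW|exact: draw_sum_sym].
  rewrite mulr0 -[X in \tr X]mul1mx trace_psd_exp_ge0 //; first exact: psd_scalar.
    exact: draw_sum_sym.
  by right; rewrite odd_double.
rewrite -mulrA -expr_div_n ler_wpM2l //.
have M0 : 0 <= K%:R * v + p.+1%:R * b by rewrite addr_ge0 ?mulr_ge0.
rewrite lerXn2r ?nnegrE ?divr_ge0 ?mulr_ge0 ?(ltW s0) //.
by rewrite ler_pdivrMr //; lra.
Qed.

(** Here b and s bound squared norms. Centering does not increase the second moment, and Jensen's
    inequality gives the mean the same bound b as the summands, so a centered summand has squared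
    norm at most 4b. *)
Lemma matrix_bernstein (R : realType) (T : finType) (K n p : nat) (y : T -> 'M[R]_n)
    (b v s : R) :
  (0 < #|T|)%N -> 0 <= b -> 0 <= v -> 0 < s ->
  (forall a, (y a)^T = y a) ->
  (forall a (u : 'cV[R]_n), frob (y a *m u) (y a *m u) <= b * frob u u) ->
  (forall u : 'cV[R]_n, avg (fun a => frob (y a *m u) (y a *m u)) <= v * frob u u) ->
  16 * p.+1%:R * (K%:R * v + p.+1%:R * (4 * b)) <= s ->
  prb R (fun w : {ffun 'I_K -> T} => ~ (forall u : 'cV[R]_n,
     let D := draw_sum y w - K%:R *: mxavg y in
     frob (D *m u) (D *m u) <= s * frob u u)) <=
  n%:R * (4^-1) ^+ p.+1.
Proof.
move=> T0 b0 v0 s0 sy hb hv hs; set m := mxavg y.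
have sm : m^T = m.
  by rewrite /m /mxavg linearZ /= raddf_sum; congr (_ *: _); apply: eq_bigr => a _ /=.
have T1 : #|T|%:R != 0 :> R by rewrite pnatr_eq0 -lt0n.
pose x a := y a - m.
have sx a : (x a)^T = x a by rewrite /x raddfB /= sy sm.
have x0 : mxavg x = 0.
  rewrite /mxavg /x sumrB scalerBr -/(mxavg y) sumr_const -/m -[m *+ _]scaler_nat scalerA.
  by rewrite mulVf // scale1r subrr.
have mu u : m *m u = (#|T|%:R)^-1 *: \sum_a (y a *m u).
  by rewrite /m /mxavg -scalemxAl mulmx_suml.
have avg_frob u z : avg (fun a => frob (y a *m u) z) = frob (m *m u) z.
  by rewrite mu frobZl frob_suml mulrC.
have var u : avg (fun a => frob (x a *m u) (x a *m u)) =
    avg (fun a => frob (y a *m u) (y a *m u)) - frob (m *m u) (m *m u).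
  have -> : avg (fun a => frob (x a *m u) (x a *m u)) =
     avg (fun a => frob (y a *m u) (y a *m u) - 2 * frob (y a *m u) (m *m u)
       + frob (m *m u) (m *m u)).
    apply: eq_avg => a; rewrite /x mulmxBl !(frobBl, frobBr) (frobC (m *m u) (y a *m u)).
    by ring.
  by rewrite avgD avgB avgZ avg_frob avg_cst //; ring.
have mb (u : 'cV[R]_n) : frob (m *m u) (m *m u) <= b * frob u u.
  have : 0 <= avg (fun a => frob (x a *m u) (x a *m u)).
    by rewrite -[X in X <= _](avg_cst 0 T0); apply: avg_le => a; exact: frob_ge0.
  have : avg (fun a => frob (y a *m u) (y a *m u)) <= b * frob u u.
    by rewrite -(avg_cst (b * frob u u) T0); apply: avg_le => a; exact: hb.
  rewrite var; lra.
have hbx a : psd ((4 * b)%:M - x a *m x a).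
  split=> [|u]; first by rewrite raddfB /= tr_scalar_mx trmx_mul sx.
  rewrite mulmxBl frobBr frob_sqr_sym // mul_scalar_mx frobZr subr_ge0.
  have := frob_ge0 (y a *m u + m *m u); have := hb a u; have := mb u.
  rewrite /x mulmxBl !(frobBl, frobBr, frobDl, frobDr) (frobC (m *m u) (y a *m u)).
  by lra.
have hvx : psd (v%:M - mxavg (fun a => x a *m x a)).
  split=> [|u].
    rewrite raddfB /= tr_scalar_mx /mxavg linearZ /= raddf_sum.
    by congr (_ - _ *: _); apply: eq_bigr => a _ /=; rewrite trmx_mul sx.
  rewrite mulmxBl frobBr mul_scalar_mx frobZr subr_ge0.
  have -> : frob u (mxavg (fun a => x a *m x a) *m u) =
      avg (fun a => frob (x a *m u) (x a *m u)).
    rewrite /mxavg -scalemxAl frobZr mulmx_suml frob_sumr mulrC; congr (_ / _).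
    by apply: eq_bigr => a _; rewrite frob_sqr_sym.
  rewrite var; have := hv u; have := frob_ge0 (m *m u); lra.
have b4 : 0 <= 4 * b by rewrite mulr_ge0.
apply: le_trans (sym_tail T0 b4 v0 s0 sx x0 hbx hvx hs); apply: prb_le => w h1 h2.
apply: h1 => u; set D := _ - _; lazy zeta; have -> : D = draw_sum x w; last exact: h2.
by rewrite /D /draw_sum /x sumrB sumr_const card_ord scaler_nat.
Qed.

(** * Spectral calculus and norms *)

(** The rows of E lie in W and those of 1 - E are orthogonal to W, so [proj_mx] fixes the former and
    kills the latter. This is how every projection given by [proj_mx] is made explicit. *)
Lemma orth_proj_unique (R : realType) (n : nat) (W E : 'M[R]_n) :
  E^T = E -> E *m E = E -> (E :=: W)%MS -> orth_proj W = E.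
Proof.
move=> sE EE EW; rewrite /orth_proj.
have /submxP [C WE] : (W <= E)%MS by rewrite EW.
have /submxP [C' EWC] : (E <= W)%MS by rewrite EW.
have cap0 : (W :&: kermx W^T = 0)%MS.
  apply/eqP; rewrite -submx0; set M := (W :&: _)%MS.
  have /submxP [D MD] : (M <= E)%MS by rewrite EW capmxSl.
  have MW : M *m W^T = 0 by apply/eqP; rewrite -sub_kermx capmxSr.
  have ME : M *m E = M by rewrite MD -mulmxA EE.
  by rewrite -ME -sE EWC trmx_mul mulmxA MW mul0mx submx0.
have E1 : E *m proj_mx W (kermx W^T) = E by rewrite proj_mx_id // EW.
have E2 : (1%:M - E) *m proj_mx W (kermx W^T) = 0.
  rewrite proj_mx_0 //; apply/sub_kermxP.
  by rewrite WE trmx_mul sE mulmxA mulmxBl mul1mx EE subrr mul0mx.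
by rewrite -[LHS]mul1mx -(subrK E 1%:M) mulmxDl E1 E2 add0r.
Qed.

Definition diag_ind (R : realType) (n : nat) (l : 'I_n -> bool) : 'M[R]_n :=
  diag_mx (\row_j (l j)%:R).

Lemma eigenspace_spectral (R : realType) (n : nat) (V : 'M[R]_n) (l : 'rV[R]_n) (a : R) :
  V *m V^T = 1%:M ->
  (eigenspace (V^T *m diag_mx l *m V) a :=: V^T *m diag_ind R (fun j => (l 0%R j == a)%B) *m V)%MS.
Proof.
move=> VV; apply/eqmxP/andP; split.
  set M := eigenspace _ _.
  have MA : M *m (V^T *m diag_mx l *m V) = a *: M by apply/eigenspaceP.
  have NA : (M *m V^T) *m diag_mx l = a *: (M *m V^T).
    by rewrite scalemxAl -MA -!mulmxA VV mulmx1.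
  apply/submxP; exists M; rewrite !mulmxA.
  suff -> : M *m V^T *m diag_ind R (fun j => l 0 j == a) = M *m V^T.
    by rewrite -mulmxA (mulmx1C VV) mulmx1.
  apply/matrixP => i j; rewrite mul_mx_diag !mxE.
  move/matrixP/(_ i j): NA; rewrite mul_mx_diag !mxE; set z := \sum_k _ => h.
  case: eqP => [_|/eqP la]; first by rewrite mulr1.
  rewrite mulr0; apply/esym/eqP; move/eqP: h; rewrite mulrC -subr_eq0 -mulrBl mulf_eq0.
  by rewrite subr_eq0 (negbTE la).
apply/eigenspaceP; rewrite /diag_ind !mulmxA -(mulmxA _ V) VV mulmx1.
rewrite -(mulmxA V^T _ (diag_mx l)) mulmx_diag scalemxAl scalemxAr; congr (_ *m _ *m _).
apply/matrixP => i j; rewrite !mxE; have [->|_] := eqVneq i j; last by rewrite !mulr0n mulr0.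
by rewrite !mulr1n; case: eqP => [->|_]; rewrite ?mul1r ?mulr1 // mul0r mulr0.
Qed.

Lemma rank_diag (R : realType) (n : nat) (d : 'rV[R]_n) :
  \rank (diag_mx d) = (\sum_j (d 0%R j != 0%R))%N.
Proof.
elim: n d => [|n IH] d; first by rewrite big_ord0; apply/eqP; rewrite -leqn0 rank_leq_row.
pose d' : 'rV[R]_(1 + n) := d.
have -> : \rank (diag_mx d) = (\rank (diag_mx (lsubmx d')) + \rank (diag_mx (rsubmx d')))%N.
  by rewrite -rank_diag_block_mx -diag_mx_row hsubmxK.
rewrite IH big_ord_recl.
congr (_ + _)%N; last by apply: eq_bigr => j _; rewrite mxE; congr (nat_of_bool (d _ _ != _)); apply/val_inj.
rewrite rank_rV; congr (nat_of_bool (negb _)).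
have lE : lsubmx d' 0 0 = d 0 0 by rewrite mxE; congr (d _ _); apply/val_inj.
apply/eqP/eqP => [/matrixP/(_ 0 0)|h]; first by rewrite [LHS]mxE [RHS]mxE lE mulr1n.
by apply/matrixP => i j; rewrite !ord1 [LHS]mxE [RHS]mxE lE h mul0rn.
Qed.

Lemma orthogonal_unit (R : realType) (n : nat) (V : 'M[R]_n) :
  V *m V^T = 1%:M -> V \in unitmx /\ V^T \in unitmx.
Proof. by move=> VV; rewrite unitmx_tr; have [] := mulmx1_unit VV. Qed.

Lemma rank_spectral (R : realType) (n : nat) (V : 'M[R]_n) (l : 'rV[R]_n) :
  V *m V^T = 1%:M -> \rank (V^T *m diag_mx l *m V) = (\sum_j (l 0%R j != 0%R))%N.
Proof.
move=> /orthogonal_unit [V1 V2].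
rewrite mxrankMfree; last by rewrite row_free_unit.
by rewrite eqmxMfull ?rank_diag // row_full_unit.
Qed.

Lemma eigenvalue_spectral (R : realType) (n : nat) (V : 'M[R]_n) (l : 'rV[R]_n) (a : R) :
  V *m V^T = 1%:M ->
  eigenvalue (V^T *m diag_mx l *m V) a = (a \in [seq l 0 j | j <- enum 'I_n]).
Proof.
move=> VV; rewrite /eigenvalue -mxrank_eq0 eigenspace_spectral // rank_spectral //.
rewrite sum_nat_eq0 negb_forall; apply/existsP/mapP => [[j]|[j _ ->]].
  rewrite mxE eqb0 negbK; case: (l 0 j =P a) => [<- _|]; first by exists j; rewrite ?mem_enum.
  by rewrite eqxx.
by exists j; rewrite mxE eqxx oner_eq0.
Qed.

(** Bridges the sums over distinct eigenvalues in the nuclear norm and the spectral calculus to sums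
    over an eigenbasis: the index j is counted once, at the eigenvalue [l 0 j], which accounts for
    multiplicities. *)
Lemma sum_eigenvalues (R : realType) (n : nat) (V : 'M[R]_n) (l : 'rV[R]_n)
    (M : zmodType) (h : 'I_n -> M) :
  V *m V^T = 1%:M ->
  \sum_(a \in [set a : R | eigenvalue (V^T *m diag_mx l *m V) a]%classic)
     \sum_j (if l 0 j == a then h j else 0) = \sum_j h j.
Proof.
move=> VV; pose s := undup [seq l 0 j | j <- enum 'I_n].
have -> : [set a : R | eigenvalue (V^T *m diag_mx l *m V) a]%classic = [set` s]%classic.
  by apply/seteqP; split=> a /=; rewrite eigenvalue_spectral // mem_undup.
rewrite -fsbig_seq ?undup_uniq // exchange_big /=; apply: eq_bigr => j _.
have js : l 0 j \in s by rewrite mem_undup map_f // mem_enum.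
rewrite (bigD1_seq (l 0 j)) ?undup_uniq //= eqxx big1 ?addr0 // => a.
by rewrite eq_sym => /negbTE ->.
Qed.

Lemma nuclear_norm_spectral (R : realType) (n : nat) (Z V : 'M[R]_n) (l : 'rV[R]_n) :
  V *m V^T = 1%:M -> Z^T *m Z = V^T *m diag_mx l *m V ->
  nuclear_norm Z = \sum_j Num.sqrt (l 0 j).
Proof.
move=> VV ZE; rewrite /nuclear_norm ZE -(sum_eigenvalues l _ VV).
apply: eq_fsbigr => a _; rewrite eigenspace_spectral // rank_spectral // -sumrMnr.
by apply: eq_bigr => j _; rewrite mxE; have [->|_] := eqVneq (l 0 j) a; rewrite ?oner_eq0 ?eqxx.
Qed.

Lemma sgnmx_spectral (R : realType) (n : nat) (V : 'M[R]_n) (l : 'rV[R]_n) :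
  V *m V^T = 1%:M ->
  sgnmx (V^T *m diag_mx l *m V) = V^T *m diag_mx (map_mx Num.sg l) *m V.
Proof.
move=> VV; rewrite /sgnmx /spectral_calculus.
have -> : V^T *m diag_mx (map_mx Num.sg l) *m V =
    \sum_j Num.sg (l 0 j) *: (V^T *m delta_mx j j *m V).
  under eq_bigr do rewrite scalemxAl scalemxAr; rewrite -mulmx_suml -mulmx_sumr.
  congr (_ *m _ *m _); apply/matrixP => i j; rewrite summxE (bigD1 i) //= !mxE eqxx /=.
  rewrite big1 ?addr0 => [|k /negbTE ki]; last by rewrite !mxE eq_sym ki mulr0.
  by rewrite [j == i]eq_sym; have [_|_] := eqVneq i j; rewrite ?mulr1 ?mulr1n ?mulr0.
rewrite -(sum_eigenvalues l _ VV); apply: eq_fsbigr => a _.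
set E := V^T *m diag_ind R (fun j => l 0 j == a) *m V.
have -> : orth_proj (eigenspace (V^T *m diag_mx l *m V) a) = E.
  apply: orth_proj_unique.
  - by rewrite /E /diag_ind !trmx_mul trmxK tr_diag_mx mulmxA.
  - rewrite /E /diag_ind !mulmxA -(mulmxA _ V) VV mulmx1 -(mulmxA V^T _ (diag_mx _)) mulmx_diag.
    congr (_ *m diag_mx _ *m _); apply/rowP => j; rewrite !mxE.
    by case: eqP; rewrite ?mulr1 ?mulr0.
  - by apply/eqmx_sym/eigenspace_spectral.
rewrite /E; have -> : diag_ind R (fun j => l 0 j == a) =
    \sum_j (if l 0 j == a then delta_mx j j else 0).
  apply/matrixP => i j; rewrite summxE (bigD1 i) //= !mxE.
  rewrite big1 ?addr0 => [|k /negbTE ki]; last first.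
    by case: ifP => _; rewrite mxE // [i == k]eq_sym ki.
  by rewrite [i == j]eq_sym; case: ifP; rewrite !mxE ?eqxx /= ?mul0rn.
rewrite mulmx_sumr mulmx_suml scaler_sumr; apply: eq_bigr => j _.
by case: eqP => [->|_] //; rewrite mulmx0 mul0mx scaler0.
Qed.

Lemma range_proj_spectral (R : realType) (n : nat) (V : 'M[R]_n) (l : 'rV[R]_n) :
  V *m V^T = 1%:M ->
  range_proj (V^T *m diag_mx l *m V) = V^T *m diag_ind R (fun j => l 0 j != 0) *m V.
Proof.
move=> VV; apply: orth_proj_unique.
- by rewrite /diag_ind !trmx_mul trmxK tr_diag_mx mulmxA.
- rewrite /diag_ind !mulmxA -(mulmxA _ V) VV mulmx1 -(mulmxA V^T _ (diag_mx _)) mulmx_diag.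
  congr (_ *m diag_mx _ *m _); apply/rowP => j; rewrite !mxE.
  by case: eqP; rewrite ?mulr1 ?mulr0.
rewrite !trmx_mul trmxK tr_diag_mx mulmxA.
have VD (d e f : 'rV[R]_n) : d = \row_j (e 0 j * f 0 j) ->
    (V^T *m diag_mx d *m V <= V^T *m diag_mx f *m V)%MS.
  move=> ->; apply/submxP; exists (V^T *m diag_mx e *m V).
  by rewrite !mulmxA -(mulmxA _ V) VV mulmx1 -(mulmxA V^T _ (diag_mx f)) mulmx_diag.
apply/eqmxP/andP; split.
  apply: (VD _ (\row_j (l 0 j)^-1)); apply/rowP => j; rewrite !mxE.
  by case: eqP => [->|/eqP ?]; rewrite ?mulr0 // mulVf.
apply: (VD _ l); apply/rowP => j; rewrite !mxE.
by case: eqP => [->|/eqP ?]; rewrite ?mulr0 ?mulr1.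
Qed.

(** All that is used later about P and sgn A: the sign is the partial isometry in the polar
    decomposition of A. In an eigenbasis every claim is an identity between diagonal entries. *)
Lemma sym_polar (R : realType) (n : nat) (A : 'M[R]_n) : A^T = A ->
  let P := range_proj A in let S := sgnmx A in
  [/\ P^T = P, P *m P = P, P *m A = A & \tr P = (\rank A)%:R] /\
  [/\ S^T = S, S *m S = P, P *m S = S & frob S A = nuclear_norm A].
Proof.
move=> sA P S; have [V [l [VV AE]]] := spectral_theorem sA.
have VMM (d e : 'rV[R]_n) : (V^T *m diag_mx d *m V) *m (V^T *m diag_mx e *m V) =
    V^T *m diag_mx (\row_j (d 0 j * e 0 j)) *m V.
  by rewrite !mulmxA -(mulmxA _ V) VV mulmx1 -(mulmxA V^T _ (diag_mx _)) mulmx_diag.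
have VT (d : 'rV[R]_n) : (V^T *m diag_mx d *m V)^T = V^T *m diag_mx d *m V.
  by rewrite !trmx_mul trmxK tr_diag_mx mulmxA.
have trV (d : 'rV[R]_n) : \tr (V^T *m diag_mx d *m V) = \sum_j d 0 j.
  by rewrite mxtrace_mulC mulmxA VV mul1mx mxtrace_diag.
have -> : S = V^T *m diag_mx (map_mx Num.sg l) *m V by rewrite /S AE sgnmx_spectral.
have -> : P = V^T *m diag_ind R (fun j => l 0 j != 0) *m V by rewrite /P AE range_proj_spectral.
split; split.
- exact: VT.
- rewrite VMM; congr (_ *m diag_mx _ *m _); apply/rowP => j; rewrite !mxE.
  by case: eqP; rewrite ?mulr1 ?mulr0.
- rewrite AE VMM; congr (_ *m diag_mx _ *m _); apply/rowP => j; rewrite !mxE.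
  by case: eqP => [->|]; rewrite ?mul1r ?mulr0.
- rewrite trV AE rank_spectral // natr_sum; apply: eq_bigr => j _; by rewrite mxE.
- exact: VT.
- rewrite VMM; congr (_ *m diag_mx _ *m _); apply/rowP => j; rewrite !mxE.
  by rewrite -sgrM -expr2 sgrX sqr_sg.
- rewrite VMM; congr (_ *m diag_mx _ *m _); apply/rowP => j; rewrite !mxE.
  by case: eqP => [->|]; rewrite ?mul1r // sgr0 mulr0.
rewrite (@nuclear_norm_spectral _ _ A V (\row_j l 0 j ^+ 2)) //; last first.
  rewrite sA {1 2}AE VMM; congr (_ *m diag_mx _ *m _).
rewrite frobE VT {1}AE VMM trV; apply: eq_bigr => j _.
by rewrite !mxE sqrtr_sqr -normrEsg.
Qed.

(** * Duality between the operator norm and the nuclear norm *)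

Lemma frob_cauchy_sqrt (R : realType) (m n : nat) (A B : 'M[R]_(m, n)) :
  frob A B <= Num.sqrt (frob A A) * Num.sqrt (frob B B).
Proof.
apply: le_trans (ler_norm _) _; rewrite -sqrtrM ?frob_ge0 // -sqrtr_sqr.
by rewrite ler_sqrt ?frob_cauchy // mulr_ge0 ?frob_ge0.
Qed.

(** With v_j the eigenvectors of Z^T Z, <W, Z> is the sum of <W v_j, Z v_j>; here |W v_j| <= 1, and
    |Z v_j| is the j-th singular value. *)
Lemma frob_le_nuclear_norm (R : realType) (n : nat) (W Z : 'M[R]_n) :
  (forall u : 'cV[R]_n, frob (W *m u) (W *m u) <= frob u u) ->
  frob W Z <= nuclear_norm Z.
Proof.
move=> hW; have sZ : (Z^T *m Z)^T = Z^T *m Z by rewrite trmx_mul trmxK.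
have [V [l [VV ZE]]] := spectral_theorem sZ.
rewrite (nuclear_norm_spectral VV ZE).
have -> : frob W Z = \sum_j frob (W *m col j V^T) (Z *m col j V^T).
  have -> : frob W Z = frob (W *m V^T) (Z *m V^T).
    by rewrite frob_mulr trmxK -mulmxA (mulmx1C VV) mulmx1.
  rewrite /frob exchange_big /=; apply: eq_bigr => j _; apply: eq_bigr => i _.
  by rewrite big_ord1 !colE !mulmxA -!colE !mxE.
apply: ler_sum => j _; apply: (le_trans (frob_cauchy_sqrt _ _)).
have e1 : frob (col j V^T) (col j V^T) = 1.
  by rewrite -tr_row frob_trmx rowE frob_mulr -mulmxA VV mulmx1 frob_delta mxE !eqxx.
have -> : frob (Z *m col j V^T) (Z *m col j V^T) = l 0 j.
  rewrite frob_mull mulmxA ZE -tr_row rowE trmx_mul -!mulmxA (mulmxA V V^T) VV mul1mx.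
  rewrite frob_mull trmxK (mulmxA V V^T) VV mul1mx.
  by rewrite trmx_delta frob_delta mul_diag_mx !mxE !eqxx mulr1.
rewrite -[leRHS]mul1r ler_wpM2r ?sqrtr_ge0 //.
by rewrite -[leRHS]sqrtr1 ler_sqrt // -e1.
Qed.

Lemma frob_mul_le (R : realType) (m n : nat) (X : 'M[R]_(m, n)) (u : 'cV[R]_n) :
  frob (X *m u) (X *m u) <= frob X X * frob u u.
Proof.
rewrite {1 2}/frob mulr_suml; apply: ler_sum => i _; rewrite big_ord1.
have := @frob_cauchy _ _ _ (row i X)^T u; rewrite frob_trmx.
have -> : frob (row i X)^T u = (X *m u) i 0.
  by rewrite frobE trmxK trace_mx11 -row_mul mxE.
have -> : frob (row i X) (row i X) = \sum_k X i k * X i k.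
  by rewrite /frob big_ord1; apply: eq_bigr => k _; rewrite mxE.
by rewrite -expr2.
Qed.

Lemma spectral_norm_bound (R : realType) (n : nat) (X : 'M[R]_n) (c : R) (u : 'cV[R]_n) :
  spectral_norm X ^+ 2 <= c -> frob (X *m u) (X *m u) <= c * frob u u.
Proof.
move=> hc; have [->|u0] := eqVneq u 0; first by rewrite mulmx0 !frob0r mulr0.
have fu : 0 < frob u u by rewrite lt_neqAle frob_ge0 eq_sym frob_eq0 u0.
set E := [set frob_norm (X *m x) | x in [set x : 'cV[R]_n | frob_norm x <= 1]]%classic.
(* A supremum is an upper bound only for a bounded set; the Frobenius norm of X bounds this one. *)
have boundE : has_ubound E.
  exists (Num.sqrt (frob X X)) => _ [x /= x1 <-].
  rewrite ler_sqrt ?frob_ge0 //.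
  have x2 : frob x x <= 1.
    by rewrite -frob_normK -[leRHS](expr1n _ 2) lerXn2r ?nnegrE // sqrtr_ge0.
  apply: (le_trans (frob_mul_le _ _)).
  by rewrite -[leRHS]mulr1 ler_wpM2l // frob_ge0.
pose s := Num.sqrt (frob u u).
have s0 : 0 < s by rewrite sqrtr_gt0.
have : E (frob_norm (X *m (s^-1 *: u))).
  exists (s^-1 *: u) => //=; rewrite /frob_norm frobZl frobZr mulrA -expr2 sqrtrM ?sqr_ge0 //.
  by rewrite sqrtr_sqr gtr0_norm ?invr_gt0 // mulVf ?gt_eqF.
move=> /(ub_le_sup boundE) h.
have h2 : frob_norm (X *m (s^-1 *: u)) ^+ 2 <= c.
  apply: le_trans hc; rewrite lerXn2r ?nnegrE ?sqrtr_ge0 //.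
  by apply: le_trans h; rewrite sqrtr_ge0.
move: h2; rewrite frob_normK -scalemxAr frobZl frobZr mulrA -invfM -expr2.
rewrite sqr_sqrtr ?frob_ge0 //.
by rewrite mulrC ler_pdivrMr.
Qed.

(** For z = X^T u, Cauchy-Schwarz applied to |z|^2 = <u, Xz> gives |z|^4 <= c |u|^2 |z|^2. *)
Lemma opnorm_trmx (R : realType) (m n : nat) (X : 'M[R]_(m, n)) (c : R) :
  0 <= c ->
  (forall u : 'cV[R]_n, frob (X *m u) (X *m u) <= c * frob u u) ->
  forall u : 'cV[R]_m, frob (X^T *m u) (X^T *m u) <= c * frob u u.
Proof.
move=> c0 hX u; set z := X^T *m u; set a := frob z z.
have a0 : 0 <= a by exact: frob_ge0.
have aE : a = frob u (X *m z) by rewrite /a {1}/z frob_mull trmxK.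
have : a ^+ 2 <= c * frob u u * a.
  rewrite {1}aE; apply: (le_trans (frob_cauchy _ _)).
  by rewrite -mulrA [leRHS]mulrCA ler_wpM2l ?frob_ge0 //; exact: hX.
have [->|an0] := eqVneq a 0; first by rewrite mulr_ge0 ?frob_ge0.
by rewrite expr2 ler_pM2r // lt_neqAle a0 eq_sym an0.
Qed.

(** * Dual certificates *)

(** The tangent projection with the projector P as a parameter; at [range_proj A] it unfolds to
    [tangent_proj A]. *)
Definition tproj (R : realType) (n : nat) (P Z : 'M[R]_n) : 'M[R]_n :=
  P *m Z + Z *m P - P *m Z *m P.

Definition nproj (R : realType) (n : nat) (P Z : 'M[R]_n) : 'M[R]_n :=
  (1%:M - P) *m Z *m (1%:M - P).

Lemma tproj_nproj (R : realType) (n : nat) (P Z : 'M[R]_n) : Z = tproj P Z + nproj P Z.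
Proof.
rewrite /tproj /nproj !(mulmxBl, mulmxBr) !(mul1mx, mulmx1).
move: (P *m Z) (Z *m P) (P *m Z *m P) => a b c.
by apply/matrixP => i j; rewrite !mxE; ring.
Qed.

Lemma frob_nprojl (R : realType) (n : nat) (P Y Z : 'M[R]_n) : P^T = P ->
  frob (nproj P Y) Z = frob Y (nproj P Z).
Proof.
move=> sP; have sQ : (1%:M - P)^T = 1%:M - P by rewrite raddfB /= trmx1 sP.
by rewrite /nproj frob_mulr frob_mull sQ mulmxA.
Qed.

Lemma tprojE (R : realType) (n : nat) (P Z : 'M[R]_n) : tproj P Z = Z - nproj P Z.
Proof. by rewrite {2}(tproj_nproj P Z) addrK. Qed.

Lemma frob_tprojl (R : realType) (n : nat) (P Y Z : 'M[R]_n) : P^T = P ->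
  frob (tproj P Y) Z = frob Y (tproj P Z).
Proof. by move=> sP; rewrite !tprojE frobBl frobBr frob_nprojl. Qed.

Lemma nproj_id (R : realType) (n : nat) (P Z : 'M[R]_n) : P *m P = P ->
  nproj P (nproj P Z) = nproj P Z.
Proof.
move=> PP; have QQ : (1%:M - P) *m (1%:M - P) = 1%:M - P.
  by rewrite mulmxBl mul1mx mulmxBr mulmx1 PP subrr subr0.
by rewrite /nproj !mulmxA QQ -mulmxA QQ.
Qed.

Lemma nprojB (R : realType) (n : nat) (P Y Z : 'M[R]_n) :
  nproj P (Y - Z) = nproj P Y - nproj P Z.
Proof. by rewrite /nproj; move: (1%:M - P) => Q; rewrite mulmxBr mulmxBl. Qed.

Lemma nprojD (R : realType) (n : nat) (P Y Z : 'M[R]_n) :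
  nproj P (Y + Z) = nproj P Y + nproj P Z.
Proof. by rewrite /nproj; move: (1%:M - P) => Q; rewrite mulmxDr mulmxDl. Qed.

Lemma nprojZ (R : realType) (n : nat) (P Z : 'M[R]_n) (c : R) :
  nproj P (c *: Z) = c *: nproj P Z.
Proof. by rewrite /nproj -scalemxAr -scalemxAl. Qed.

Lemma tproj_id (R : realType) (n : nat) (P Z : 'M[R]_n) : P *m P = P ->
  tproj P (tproj P Z) = tproj P Z.
Proof. by move=> PP; rewrite !tprojE nprojB nproj_id // subrr subr0. Qed.

Lemma nproj_tproj (R : realType) (n : nat) (P Z : 'M[R]_n) : P *m P = P ->
  nproj P (tproj P Z) = 0.
Proof. by move=> PP; rewrite tprojE nprojB nproj_id // subrr. Qed.

Lemma nproj_opnorm (R : realType) (n : nat) (P Z : 'M[R]_n) (c : R) : 0 <= c ->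
  P^T = P -> P *m P = P ->
  (forall u : 'cV[R]_n, frob (Z *m u) (Z *m u) <= c * frob u u) ->
  forall u : 'cV[R]_n, frob (nproj P Z *m u) (nproj P Z *m u) <=
    c * frob ((1%:M - P) *m u) ((1%:M - P) *m u).
Proof.
move=> c0 sP PP hZ u; pose Q := 1%:M - P.
have QQ : Q *m Q = Q by rewrite /Q mulmxBl mul1mx mulmxBr mulmx1 PP subrr subr0.
have sQ : Q^T = Q by rewrite /Q raddfB /= trmx1 sP.
have pyth (z : 'cV[R]_n) : frob (Q *m z) (Q *m z) <= frob z z.
  have : frob z z = frob (Q *m z) (Q *m z) + frob (z - Q *m z) (z - Q *m z).
    have qz : frob (Q *m z) (Q *m z) = frob z (Q *m z) by rewrite frob_mull sQ mulmxA QQ.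
    by rewrite !(frobBl, frobBr) (frobC (Q *m z) z) qz; ring.
  by have := frob_ge0 (z - Q *m z); lra.
by rewrite /nproj -!mulmxA; apply: le_trans (pyth _) _; exact: hZ.
Qed.

(* The subgradient W below certifies optimality: its normal part may be completed
   by the normalised normal part of the perturbation H. *)
Lemma dual_certificate (R : realType) (n : nat) (A : 'M[R]_n)
    (X : 'I_(n ^ 2) -> 'M[R]_n) (Omega : {set 'I_(n ^ 2)}) (Y : 'M[R]_n) (e d : R) :
  let P := range_proj A in
  A^T = A -> 0 <= d -> 0 <= e -> 4 * e * d < 1 ->
  (forall H : 'M[R]_n, (forall a, a \in Omega -> frob (X a) H = 0) -> frob Y H = 0) ->
  frob (sgnmx A - tproj P Y) (sgnmx A - tproj P Y) <= e ->
  (forall u : 'cV[R]_n, frob (nproj P Y *m u) (nproj P Y *m u) <= 4^-1 * frob u u) ->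
  (forall H : 'M[R]_n, (forall a, a \in Omega -> frob (X a) H = 0) ->
     frob (tproj P H) (tproj P H) <= d * frob (nproj P H) (nproj P H)) ->
  forall Z : 'M[R]_n, is_minimizer A X Omega Z <-> Z = A.
Proof.
move=> P sA d0 e0 ed hY hE hN hT.
have := sym_polar sA; rewrite -/P; set S := sgnmx A in hE *.
move=> [[sP PP PA _] [sS SS PS SA]]; clearbody P.
have SP : S *m P = S by rewrite -[S in LHS]sS -sP -trmx_mul PS sS.
have nS : nproj P S = 0 by rewrite /nproj mulmxBl mul1mx PS subrr mul0mx.
have nA : nproj P A = 0 by rewrite /nproj mulmxBl mul1mx PA subrr mul0mx.
have strict Z : feasible A X Omega Z -> Z <> A -> nuclear_norm A < nuclear_norm Z.
  move=> fZ ZA; pose H := Z - A.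
  have HO a : a \in Omega -> frob (X a) H = 0.
    by move=> aO; rewrite frobBr fZ // subrr.
  pose F2 := frob (nproj P H) (nproj P H); pose F := Num.sqrt F2.
  have FF : F ^+ 2 = F2 by rewrite sqr_sqrtr ?frob_ge0.
  (* A feasible direction with zero normal part has zero tangential part by [hT], hence vanishes. *)
  have F0 : F2 != 0.
    apply/eqP => F20; apply: ZA; apply/eqP; rewrite -subr_eq0 -/H.
    have := hT H HO; rewrite -/F2 F20 mulr0 => h.
    have t0 : tproj P H = 0 by apply/eqP; rewrite -frob_eq0 eq_le h frob_ge0.
    have n0 : nproj P H = 0 by apply/eqP; rewrite -frob_eq0; apply/eqP.
    by rewrite (tproj_nproj P H) t0 n0 addr0.
  have Fp : 0 < F by rewrite sqrtr_gt0 lt_neqAle frob_ge0 eq_sym F0.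
  (* The scaling gives the normalised part Frobenius norm 1/2. Added to the normal part of Y, of
     operator norm at most 1/2, it yields M of norm at most 1. *)
  pose c := (2 * F)^-1; pose M := nproj P Y + c *: nproj P H; pose W := S + M.
  have MnM : M = nproj P M by rewrite /M nprojD nprojZ !nproj_id.
  have Mb (u : 'cV[R]_n) : frob (M *m u) (M *m u) <= 1 * frob u u.
    rewrite /M mulmxDl; set a := _ *m u; set b := _ *m u.
    have ha : frob a a <= 4^-1 * frob u u by exact: hN.
    have hb : frob b b <= 4^-1 * frob u u.
      rewrite /b -scalemxAl frobZl frobZr mulrA.
      have -> : 4^-1 * frob u u = c * c * (F2 * frob u u).
        by rewrite -FF /c; field; rewrite gt_eqF.
      by rewrite ler_wpM2l ?frob_mul_le // -expr2 sqr_ge0.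
    have := frob_ge0 (a - b); rewrite !(frobBl, frobBr, frobDl, frobDr) (frobC b a).
    by lra.
  have Wb (u : 'cV[R]_n) : frob (W *m u) (W *m u) <= frob u u.
    rewrite /W mulmxDl !(frobDl, frobDr).
    have c0 : frob (S *m u) (M *m u) = 0.
      have PQ : P *m (1%:M - P) = 0 by rewrite mulmxBr mulmx1 PP subrr.
      by rewrite -{1}PS -mulmxA frob_mull sP mulmxA MnM /nproj !mulmxA PQ !mul0mx frob0r.
    rewrite c0 (frobC (M *m u)) c0.
    have := nproj_opnorm ler01 sP PP Mb u; rewrite -MnM.
    have -> : frob (S *m u) (S *m u) = frob (P *m u) (P *m u).
      by rewrite !frob_mull sS sP !mulmxA SS PP.
    have -> : frob u u = frob (P *m u) (P *m u) + frob ((1%:M - P) *m u) ((1%:M - P) *m u).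
      have pu : frob (P *m u) (P *m u) = frob u (P *m u) by rewrite frob_mull sP mulmxA PP.
      by rewrite mulmxBl mul1mx !(frobBl, frobBr) (frobC (P *m u) u) pu; ring.
    by lra.
  have WA : frob W A = nuclear_norm A.
    by rewrite /W frobDl MnM frob_nprojl // nA frob0r addr0.
  have := frob_le_nuclear_norm Z Wb; apply: lt_le_trans.
  have -> : Z = A + H by rewrite /H addrC subrK.
  rewrite frobDr WA ltrDl.
  pose E := S - tproj P Y; have EE : E = tproj P E.
    by rewrite /E !tprojE !nprojB nproj_id // nS !subrr !subr0.
  (* Subtracting <Y, H> = 0 leaves the certificate error E against the tangential part. Its square
     is at most e d F^2 < F^2/4, so the gain F/2 prevails. *)
  have -> : frob W H = frob E (tproj P H) + F / 2.
    have -> : frob E (tproj P H) = frob E H by rewrite -frob_tprojl // -EE.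
    have -> : frob E H = frob S H + frob (nproj P Y) H.
      by rewrite /E tprojE !frobBl (hY H HO); ring.
    rewrite /W /M !frobDl frobZl.
    have -> : frob (nproj P H) H = F ^+ 2.
      by rewrite FF /F2 -[in LHS](nproj_id H PP) frob_nprojl.
    by rewrite /c; field; rewrite gt_eqF.
  have h := frob_cauchy E (tproj P H); set x := frob E _ in h *.
  have : x ^+ 2 < (F / 2) ^+ 2.
    apply: (le_lt_trans h); apply: (@le_lt_trans _ _ (e * (d * F2))).
      by apply: ler_pM; rewrite ?frob_ge0 //; exact: hT.
    have F2p : 0 < F2 by rewrite -FF exprn_gt0.
    by rewrite -(ltr_pM2r F2p) in ed; rewrite expr_div_n FF; lra.
  rewrite -ltr_sqrt ?exprn_gt0 ?divr_gt0 // !sqrtr_sqr (gtr0_norm (divr_gt0 Fp _)) //.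
  by rewrite ltr_norml => /andP [hx _]; lra.
move=> Z; split=> [[fZ minZ]|->].
  apply: contrapT => ZA; have := strict Z fZ ZA.
  by rewrite ltNge minZ // => a _.
split=> [//|Z' fZ']; have [->|/eqP ZA] := eqVneq Z' A; first by [].
by apply: ltW; exact: strict.
Qed.

(** * One batch of random draws *)

Lemma basis_expand (R : realType) (n : nat) (X : 'I_(n ^ 2) -> 'M[R]_n) (Z : 'M[R]_n) :
  orthonormal_basis X -> Z = \sum_a frob (X a) Z *: X a.
Proof.
move=> [bX oX]; apply/eqP; rewrite -subr_eq0; set D := Z - _.
have DX a : frob D (X a) = 0.
  rewrite /D frobBl frob_suml (bigD1 a) //= frobZl oX eqxx mulr1 frobC.
  rewrite big1 ?addr0 ?subrr // => b /negbTE ba.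
  by rewrite frobZl oX ba mulr0.
have : D \in <<in_tuple [seq X a | a : 'I_(n ^ 2)]>>%VS by rewrite (span_basis bX) memvf.
set t := in_tuple _; move=> /coord_span DE.
rewrite -frob_eq0 {2}DE frob_sumr; apply/eqP/big1 => i _; rewrite frobZr.
have /mapP [a _ taX] : t`_i \in [seq X a | a : 'I_(n ^ 2)] by apply: mem_nth.
by rewrite taX DX mulr0.
Qed.

Lemma parseval (R : realType) (n : nat) (X : 'I_(n ^ 2) -> 'M[R]_n) (Y Z : 'M[R]_n) :
  orthonormal_basis X -> \sum_a frob (X a) Y * frob (X a) Z = frob Y Z.
Proof.
move=> oX; rewrite [in RHS](basis_expand Y oX) frob_suml.
by apply: eq_bigr => a _; rewrite frobZl.
Qed.

Lemma parseval_rank1 (R : realType) (n : nat) (X : 'I_(n ^ 2) -> 'M[R]_n) (x y : 'cV[R]_n) :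
  orthonormal_basis X -> \sum_a frob (X a) (x *m y^T) ^+ 2 = frob x x * frob y y.
Proof.
move=> oX; under eq_bigr do rewrite expr2; rewrite parseval //.
rewrite frob_mull mulmxA.
have -> : x^T *m x = (frob x x)%:M by rewrite [LHS]mx11_scalar frobE trace_mx11.
by rewrite mul_scalar_mx frobZr frob_trmx.
Qed.

Lemma frob_delta_vec (R : realType) (n : nat) (i : 'I_n) :
  frob (delta_mx i 0 : 'cV[R]_n) (delta_mx i 0) = 1.
Proof. by rewrite frob_delta mxE !eqxx. Qed.

Lemma mulmx_entry (R : realType) (m n : nat) (M : 'M[R]_(m, n)) (u : 'cV[R]_n) i :
  (M *m u) i 0 = frob M (delta_mx i 0 *m u^T).
Proof. by rewrite frobC frob_mulr trmxK frob_delta. Qed.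

Lemma frob_colE (R : realType) (n : nat) (u : 'cV[R]_n) :
  frob u u = \sum_i u i 0 ^+ 2.
Proof. by apply: eq_bigr => i _; rewrite big_ord1 expr2. Qed.

(** The sum of X_a^T X_a is n times the identity for every orthonormal basis: entry i of X_a u is
    the coefficient of the rank-one matrix e_i u^T along X_a. *)
Lemma sum_frob_basis (R : realType) (n : nat) (X : 'I_(n ^ 2) -> 'M[R]_n) (u : 'cV[R]_n) :
  orthonormal_basis X -> \sum_a frob (X a *m u) (X a *m u) = n%:R * frob u u.
Proof.
move=> oX; under eq_bigr do rewrite frob_colE; rewrite exchange_big /=.
rewrite mulr_natl; transitivity (\sum_(i < n) frob u u); last by rewrite sumr_const card_ord.
apply: eq_bigr => i _.
under eq_bigr do rewrite mulmx_entry.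
by rewrite parseval_rank1 // frob_delta_vec mul1r.
Qed.

Lemma sum_frob_basis_tr (R : realType) (n : nat) (X : 'I_(n ^ 2) -> 'M[R]_n) (u : 'cV[R]_n) :
  orthonormal_basis X -> \sum_a frob ((X a)^T *m u) ((X a)^T *m u) = n%:R * frob u u.
Proof.
move=> oX; under eq_bigr do rewrite frob_colE; rewrite exchange_big /=.
rewrite mulr_natl; transitivity (\sum_(i < n) frob u u); last by rewrite sumr_const card_ord.
apply: eq_bigr => i _.
under eq_bigr do rewrite mulmx_entry -frob_trmx trmxK trmx_mul trmxK.
by rewrite parseval_rank1 // frob_delta_vec mulr1.
Qed.

Lemma tprojD (R : realType) (n : nat) (P Y Z : 'M[R]_n) :
  tproj P (Y + Z) = tproj P Y + tproj P Z.
Proof. by rewrite !tprojE nprojD opprD addrACA. Qed.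

Lemma tprojZ (R : realType) (n : nat) (P Z : 'M[R]_n) (c : R) :
  tproj P (c *: Z) = c *: tproj P Z.
Proof. by rewrite !tprojE nprojZ scalerBr. Qed.

Lemma tproj0 (R : realType) (n : nat) (P : 'M[R]_n) : tproj P 0 = 0.
Proof. by rewrite -(scale0r 0) tprojZ !scale0r. Qed.

Lemma tproj_sum (R : realType) (n : nat) (P : 'M[R]_n) (I : finType) (F : I -> 'M[R]_n) :
  tproj P (\sum_i F i) = \sum_i tproj P (F i).
Proof. by elim/big_rec2: _ => [|i y1 y2 _ <-]; rewrite ?tproj0 ?tprojD. Qed.

Lemma frob_tproj_le (R : realType) (n : nat) (P Z : 'M[R]_n) :
  P^T = P -> P *m P = P -> frob (tproj P Z) (tproj P Z) <= frob Z Z.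
Proof.
move=> sP PP; have : frob Z Z = frob (tproj P Z) (tproj P Z) + frob (nproj P Z) (nproj P Z).
  have c0 : frob (nproj P Z) (tproj P Z) = 0 by rewrite frob_nprojl // nproj_tproj // frob0r.
  rewrite [in LHS](tproj_nproj P Z); move: (tproj P Z) (nproj P Z) c0 => a b c0.
  by rewrite !(frobDl, frobDr) (frobC a b) c0; ring.
by have := frob_ge0 (nproj P Z); lra.
Qed.

(* The sampling operator of a batch of draws, normalised to have mean the identity. *)
Definition batch_op (R : realType) (n K : nat) (X : 'I_(n ^ 2) -> 'M[R]_n)
    (w : {ffun 'I_K -> 'I_(n ^ 2)}) (Z : 'M[R]_n) : 'M[R]_n :=
  ((n ^ 2)%:R / K%:R) *: \sum_k frob (X (w k)) Z *: X (w k).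

(** In these coordinates an operator on matrices becomes an n^2 by n^2 matrix, to which
    [matrix_bernstein] applies. *)
Definition coordv (R : realType) (n : nat) (X : 'I_(n ^ 2) -> 'M[R]_n) (Z : 'M[R]_n) :
  'cV[R]_(n ^ 2) := \col_a frob (X a) Z.

Lemma frob_coordv (R : realType) (n : nat) (X : 'I_(n ^ 2) -> 'M[R]_n) (Y Z : 'M[R]_n) :
  orthonormal_basis X -> frob (coordv X Y) (coordv X Z) = frob Y Z.
Proof.
by move=> oX; rewrite -(parseval Y Z oX); apply: eq_bigr => a _; rewrite big_ord1 !mxE.
Qed.

Lemma coordvB (R : realType) (n : nat) (X : 'I_(n ^ 2) -> 'M[R]_n) (Y Z : 'M[R]_n) :
  coordv X (Y - Z) = coordv X Y - coordv X Z.
Proof. by apply/colP => a; rewrite !mxE frobBr. Qed.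

Lemma coordvZ (R : realType) (n : nat) (X : 'I_(n ^ 2) -> 'M[R]_n) (c : R) (Z : 'M[R]_n) :
  coordv X (c *: Z) = c *: coordv X Z.
Proof. by apply/colP => a; rewrite !mxE frobZr. Qed.

Lemma coordv_sum (R : realType) (n : nat) (X : 'I_(n ^ 2) -> 'M[R]_n) (I : finType)
    (F : I -> 'M[R]_n) : coordv X (\sum_i F i) = \sum_i coordv X (F i).
Proof. by apply/colP => a; rewrite summxE !mxE frob_sumr; apply: eq_bigr => i _; rewrite mxE. Qed.

Lemma coordv_surj (R : realType) (n : nat) (X : 'I_(n ^ 2) -> 'M[R]_n) (u : 'cV[R]_(n ^ 2)) :
  orthonormal_basis X -> u = coordv X (\sum_a u a 0 *: X a).
Proof.
move=> [_ oX]; apply/colP => b; rewrite mxE frob_sumr (bigD1 b) //= frobZr oX eqxx mulr1.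
by rewrite big1 ?addr0 // => a /negbTE ab; rewrite frobZr oX eq_sym ab mulr0.
Qed.

Lemma natr_neq0 (R : realType) (n : nat) : (0 < n)%N -> n%:R != 0 :> R.
Proof. by move=> n0; rewrite pnatr_eq0 -lt0n. Qed.

Lemma mulr_mean_cancel (R : realType) (M k f : R) :
  M != 0 -> k != 0 -> k * M^-1 * (M / k * f) = f.
Proof. by move=> M0 k0; field; rewrite M0 k0. Qed.

(** In coordinates, P_T R P_T is a sum of rank-one matrices (N/K) q q^T with N = n^2 and |q|^2 <=
    mu. Each has norm at most N mu/K, and its square is at most that number times itself, so the
    second moment follows from the mean, which is P_T/K. *)
Lemma batch_contraction (R : realType) (n K p : nat) (X : 'I_(n ^ 2) -> 'M[R]_n)
    (P : 'M[R]_n) (mu : R) :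
  (0 < n)%N -> (0 < K)%N -> orthonormal_basis X -> P^T = P -> P *m P = P -> 0 <= mu ->
  (forall a, frob (tproj P (X a)) (tproj P (X a)) <= mu) ->
  16 * p.+1%:R * ((n ^ 2)%:R * mu / K%:R + p.+1%:R * (4 * ((n ^ 2)%:R * mu / K%:R) ^+ 2))
    <= 4^-1 ->
  prb R (fun w : {ffun 'I_K -> 'I_(n ^ 2)} => ~ (forall Z, tproj P Z = Z ->
    frob (Z - tproj P (batch_op X w Z)) (Z - tproj P (batch_op X w Z)) <= 4^-1 * frob Z Z))
  <= (n ^ 2)%:R * 4^-1 ^+ p.+1.
Proof.
move=> n0 K0 oX sP PP mu0 hmu hp.
pose N : R := (n ^ 2)%:R; pose q a := coordv X (tproj P (X a)).
pose y a := (N / K%:R) *: (q a *m (q a)^T).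
have N0 : N != 0 by rewrite natr_neq0 // expn_gt0 n0.
have k0 : K%:R != 0 :> R by exact: natr_neq0.
have c0 : 0 <= N / K%:R by rewrite divr_ge0.
have qq a : frob (q a) (q a) <= mu by rewrite /q frob_coordv.
have yu a (u : 'cV[R]_(n ^ 2)) : y a *m u = (N / K%:R * frob (q a) u) *: q a.
  rewrite /y -scalemxAl -mulmxA.
  have -> : (q a)^T *m u = (frob (q a) u)%:M by rewrite [LHS]mx11_scalar frobE trace_mx11.
  by rewrite mul_mx_scalar scalerA.
have yuu a (u : 'cV[R]_(n ^ 2)) : frob (y a *m u) (y a *m u) <=
    (N / K%:R) ^+ 2 * mu * frob (q a) u ^+ 2.
  rewrite yu frobZl frobZr; move: (N / K%:R) (frob (q a) u) (qq a) => c f h.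
  have := ler_wpM2l (mulr_ge0 (sqr_ge0 c) (sqr_ge0 f)) h; rewrite !expr2; lra.
have T0 : (0 < #|'I_(n ^ 2)|)%N by rewrite card_ord expn_gt0 n0.
apply: le_trans (@matrix_bernstein R 'I_(n ^ 2) K (n ^ 2) p y ((N * mu / K%:R) ^+ 2)
   (N * mu / K%:R ^+ 2) 4^-1 T0 _ _ _ _ _ _ _); last first.
- have -> : K%:R * (N * mu / K%:R ^+ 2) = N * mu / K%:R by field.
  exact: hp.
- move=> u; apply: (@le_trans _ _ ((N / K%:R) ^+ 2 * mu * avg (fun a => frob (q a) u ^+ 2))).
    by rewrite -avgZ; apply: avg_le.
  rewrite [u in leLHS](coordv_surj u oX); set U := \sum_a _.
  have -> : avg (fun a => frob (q a) (coordv X U) ^+ 2) = frob (tproj P U) (tproj P U) / N.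
    rewrite /avg card_ord -(parseval _ _ oX); congr (_ / _).
    by apply: eq_bigr => a _; rewrite /q frob_coordv // frob_tprojl // expr2.
  have aux (M k m f : R) : M != 0 -> k != 0 -> (M / k) ^+ 2 * m * (f / M) = M * m / k ^+ 2 * f.
    by move=> M0 kk0; field; rewrite kk0 M0.
  rewrite aux //.
  rewrite ler_wpM2l //; first by rewrite divr_ge0 ?mulr_ge0 // exprn_ge0.
  by rewrite [u in leRHS](coordv_surj u oX) frob_coordv //; exact: frob_tproj_le.
- move=> a u; apply: (le_trans (yuu a u)).
  apply: (@le_trans _ _ ((N / K%:R) ^+ 2 * mu * (mu * frob u u))).
    rewrite ler_wpM2l ?mulr_ge0 ?exprn_ge0 //.
    by apply: (le_trans (frob_cauchy _ _)); rewrite ler_wpM2r ?frob_ge0.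
  by rewrite le_eqVlt; apply/orP; left; apply/eqP; field.
- by move=> a; rewrite /y linearZ /= trmx_mul trmxK.
- by rewrite invr_gt0.
- by rewrite divr_ge0 ?mulr_ge0 // exprn_ge0.
- by rewrite sqr_ge0.
apply: prb_le => w; apply: contra_not => h Z ZT; have := h (coordv X Z).
lazy zeta; set D := draw_sum y w - _.
have -> : D *m coordv X Z = - coordv X (Z - tproj P (batch_op X w Z)).
  rewrite /D mulmxBl.
  have qZ a : frob (q a) (coordv X Z) = frob (X a) Z by rewrite frob_coordv // frob_tprojl // ZT.
  have -> : draw_sum y w *m coordv X Z = coordv X (tproj P (batch_op X w Z)).
    rewrite /draw_sum mulmx_suml /batch_op tprojZ tproj_sum coordvZ coordv_sum scaler_sumr.
    by apply: eq_bigr => k _; rewrite yu qZ tprojZ coordvZ scalerA.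
  have -> : (K%:R *: mxavg y) *m coordv X Z = coordv X Z.
    rewrite /mxavg card_ord scalerA -scalemxAl mulmx_suml.
    rewrite -{2}ZT {2}(basis_expand Z oX) tproj_sum coordv_sum scaler_sumr.
    apply: eq_bigr => a _; rewrite yu qZ tprojZ coordvZ scalerA; congr (_ *: _).
    by apply: mulr_mean_cancel.
  by rewrite coordvB opprB.
by rewrite frobNl frobNr opprK !frob_coordv.
Qed.

(** Symmetric dilation: it makes the tail bound available for basis matrices that are not symmetric,
    at the price of doubling the dimension. *)
Definition dilation (R : realType) (n : nat) (M : 'M[R]_n) : 'M[R]_(n + n) :=
  block_mx 0 M M^T 0.

Lemma dilationB (R : realType) (n : nat) (M M' : 'M[R]_n) :
  dilation (M - M') = dilation M - dilation M'.
Proof. by rewrite /dilation opp_block_mx add_block_mx !subrr raddfB. Qed.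

Lemma dilationD (R : realType) (n : nat) (M M' : 'M[R]_n) :
  dilation (M + M') = dilation M + dilation M'.
Proof. by rewrite /dilation add_block_mx !addr0 raddfD. Qed.

Lemma dilationZ (R : realType) (n : nat) (c : R) (M : 'M[R]_n) :
  dilation (c *: M) = c *: dilation M.
Proof. by rewrite /dilation scale_block_mx !scaler0 linearZ. Qed.

Lemma dilation_sum (R : realType) (n : nat) (I : finType) (F : I -> 'M[R]_n) :
  dilation (\sum_i F i) = \sum_i dilation (F i).
Proof.
elim/big_rec2: _ => [|i y1 y2 _ <-]; last exact: dilationD.
by rewrite -(scale0r 0) dilationZ !scale0r.
Qed.

Lemma dilation_mul (R : realType) (n : nat) (M : 'M[R]_n) (x z : 'cV[R]_n) :
  dilation M *m col_mx x z = col_mx (M *m z) (M^T *m x).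
Proof. by rewrite mul_block_col !mul0mx add0r addr0. Qed.

Lemma frob_col_mx (R : realType) (m n : nat) (x : 'cV[R]_m) (z : 'cV[R]_n) :
  frob (col_mx x z) (col_mx x z) = frob x x + frob z z.
Proof.
rewrite !frob_colE big_split_ord; congr (_ + _); apply: eq_bigr => i _.
  by rewrite col_mxEu.
by rewrite col_mxEd.
Qed.

(** As Z is tangent, the normal part of R Z is that of the deviation R Z - Z, and compression by 1 -
    P does not increase the norm. The square of a dilation is block diagonal, whence one variance
    bound for the X_a and one for their transposes. *)
Lemma batch_normal (R : realType) (n K p : nat) (X : 'I_(n ^ 2) -> 'M[R]_n)
    (P Z : 'M[R]_n) (B V t : R) :
  (0 < n)%N -> (0 < K)%N -> orthonormal_basis X -> P^T = P -> P *m P = P ->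
  tproj P Z = Z -> 0 <= B -> 0 <= V -> 0 < t ->
  (forall a (u : 'cV[R]_n), ((n ^ 2)%:R / K%:R) ^+ 2 * frob (X a) Z ^+ 2 *
     frob (X a *m u) (X a *m u) <= B * frob u u) ->
  (forall u : 'cV[R]_n, \sum_a frob (X a) Z ^+ 2 * frob (X a *m u) (X a *m u)
     <= V * frob u u) ->
  (forall u : 'cV[R]_n, \sum_a frob (X a) Z ^+ 2 * frob ((X a)^T *m u) ((X a)^T *m u)
     <= V * frob u u) ->
  16 * p.+1%:R * ((n ^ 2)%:R * V / K%:R + p.+1%:R * (4 * B)) <= t ->
  prb R (fun w : {ffun 'I_K -> 'I_(n ^ 2)} => ~ (forall u : 'cV[R]_n,
    frob (nproj P (batch_op X w Z) *m u) (nproj P (batch_op X w Z) *m u) <= t * frob u u))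
  <= (n + n)%:R * 4^-1 ^+ p.+1.
Proof.
move=> n0 K0 oX sP PP ZT B0 V0 t0 hB hV hV' hp.
pose N : R := (n ^ 2)%:R; pose c a := N / K%:R * frob (X a) Z.
pose y a := dilation (c a *: X a).
have N0 : N != 0 by rewrite natr_neq0 // expn_gt0 n0.
have k0 : K%:R != 0 :> R by exact: natr_neq0.
have T0 : (0 < #|'I_(n ^ 2)|)%N by rewrite card_ord expn_gt0 n0.
have yuE a (u : 'cV[R]_(n + n)) : frob (y a *m u) (y a *m u) =
   (N / K%:R) ^+ 2 * (frob (X a) Z ^+ 2 * frob (X a *m dsubmx u) (X a *m dsubmx u) +
   frob (X a) Z ^+ 2 * frob ((X a)^T *m usubmx u) ((X a)^T *m usubmx u)).
  rewrite -{1 2}[u]vsubmxK /y dilation_mul frob_col_mx linearZ /= -!scalemxAl.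
  by rewrite !(frobZl, frobZr) /c; ring.
have uE (u : 'cV[R]_(n + n)) : frob u u = frob (dsubmx u) (dsubmx u) + frob (usubmx u) (usubmx u).
  by rewrite -{1 2}[u]vsubmxK frob_col_mx addrC.
have hB' a (u : 'cV[R]_n) : (N / K%:R) ^+ 2 * frob (X a) Z ^+ 2 *
     frob ((X a)^T *m u) ((X a)^T *m u) <= B * frob u u.
  have h (z : 'cV[R]_n) : frob ((c a *: X a) *m z) ((c a *: X a) *m z) <= B * frob z z.
    by apply: le_trans (hB a z); rewrite -scalemxAl frobZl frobZr mulrA -expr2 exprMn.
  by have := opnorm_trmx B0 h u; rewrite linearZ /= -scalemxAl frobZl frobZr mulrA -expr2 exprMn.
apply: le_trans (@matrix_bernstein R 'I_(n ^ 2) K (n + n) p y B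
   (N * V / K%:R ^+ 2) t T0 B0 _ t0 _ _ _ _); last first.
- have -> : K%:R * (N * V / K%:R ^+ 2) = N * V / K%:R by field.
  exact: hp.
- move=> u; rewrite /avg card_ord -/N; under eq_bigr do rewrite yuE.
  rewrite -mulr_sumr big_split /= uE.
  have aux (M k x b : R) : M != 0 -> k != 0 -> x <= V * b -> 0 <= M -> 
      (M / k) ^+ 2 * x / M <= M * V / k ^+ 2 * b.
    move=> M0 kk0 xb Mp; have -> : (M / k) ^+ 2 * x / M = M / k ^+ 2 * x by field; rewrite kk0 M0.
    have -> : M * V / k ^+ 2 * b = M / k ^+ 2 * (V * b) by ring.
    by rewrite ler_wpM2l // divr_ge0 // sqr_ge0.
  by apply: aux => //; rewrite mulrDr lerD.
- move=> a u; rewrite yuE uE !mulrDr.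
  by apply: lerD; rewrite [leLHS]mulrA; [exact: hB|exact: hB'].
- by move=> a; rewrite /y /dilation tr_block_mx !trmx0 trmxK.
- by rewrite divr_ge0 ?mulr_ge0 // exprn_ge0.
apply: prb_le => w; apply: contra_not => h u.
have DE : draw_sum y w - K%:R *: mxavg y = dilation (batch_op X w Z - Z).
  rewrite dilationB; congr (_ - _).
    rewrite /draw_sum /batch_op /y -dilation_sum scaler_sumr; congr dilation.
    by apply: eq_bigr => k _; rewrite scalerA.
  rewrite /mxavg /y -dilation_sum -!dilationZ; congr dilation; rewrite [RHS](basis_expand Z oX).
  rewrite scalerA scaler_sumr card_ord; apply: eq_bigr => a _.
  by rewrite scalerA; congr (_ *: _); apply: mulr_mean_cancel.
have op (z : 'cV[R]_n) : frob ((batch_op X w Z - Z) *m z) ((batch_op X w Z - Z) *m z)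
   <= t * frob z z.
  have := h (col_mx 0 z); lazy zeta; rewrite DE.
  by rewrite dilation_mul !frob_col_mx mulmx0 !frob0r addr0 add0r.
have nZ : nproj P Z = 0 by rewrite -ZT nproj_tproj.
have -> : nproj P (batch_op X w Z) = nproj P (batch_op X w Z - Z).
  by rewrite nprojB nZ subr0.
have pyth : frob ((1%:M - P) *m u) ((1%:M - P) *m u) <= frob u u.
  have pu : frob (P *m u) (P *m u) = frob u (P *m u) by rewrite frob_mull sP mulmxA PP.
  rewrite mulmxBl mul1mx !(frobBl, frobBr) (frobC (P *m u) u).
  by have := frob_ge0 (P *m u); rewrite pu; lra.
apply: (le_trans (nproj_opnorm (ltW t0) sP PP op u)).
by rewrite ler_wpM2l // ltW.
Qed.

(** The tail bound for 1 by 1 matrices. The weights g_a = <X_b, P_T X_a> satisfy |g_a| <= mu, and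
    their squares sum to |P_T X_b|^2 <= mu. *)
Lemma batch_coord (R : realType) (n K p : nat) (X : 'I_(n ^ 2) -> 'M[R]_n)
    (P Z : 'M[R]_n) (mu t : R) (b : 'I_(n ^ 2)) :
  (0 < n)%N -> (0 < K)%N -> orthonormal_basis X -> P^T = P -> P *m P = P ->
  tproj P Z = Z -> 0 <= mu -> 0 < t ->
  (forall a, frob (tproj P (X a)) (tproj P (X a)) <= mu) ->
  (forall a, frob (X a) Z ^+ 2 <= t) ->
  16 * p.+1%:R * ((n ^ 2)%:R * mu / K%:R + p.+1%:R * (4 * ((n ^ 2)%:R * mu / K%:R) ^+ 2))
    <= 4^-1 ->
  prb R (fun w : {ffun 'I_K -> 'I_(n ^ 2)} =>
    ~ (frob (X b) (Z - tproj P (batch_op X w Z)) ^+ 2 <= 4^-1 * t)) <= 4^-1 ^+ p.+1.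
Proof.
move=> n0 K0 oX sP PP ZT mu0 t0 hmu ht hp.
pose N : R := (n ^ 2)%:R; pose g a := frob (X b) (tproj P (X a)).
pose c a := N / K%:R * (g a * frob (X a) Z); pose y a : 'M[R]_1 := (c a)%:M.
have N0 : N != 0 by rewrite natr_neq0 // expn_gt0 n0.
have k0 : K%:R != 0 :> R by exact: natr_neq0.
have T0 : (0 < #|'I_(n ^ 2)|)%N by rewrite card_ord expn_gt0 n0.
have yuE a (u : 'cV[R]_1) : frob (y a *m u) (y a *m u) = c a ^+ 2 * frob u u.
  by rewrite /y mul_scalar_mx frobZl frobZr mulrA.
have gE a : g a = frob (tproj P (X b)) (X a) by rewrite /g frob_tprojl.
have g2 a : g a ^+ 2 <= mu * mu.
  have -> : g a = frob (tproj P (X b)) (tproj P (X a)) by rewrite frob_tprojl // tproj_id.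
  apply: (le_trans (frob_cauchy _ _)).
  by apply: ler_pM; rewrite ?frob_ge0.
have gsum : \sum_a g a ^+ 2 <= mu.
  apply: le_trans (hmu b); rewrite -(parseval _ _ oX).
  by apply: ler_sum => a _; rewrite gE expr2 frobC.
have aux1 (k : R) : k != 0 -> k * (N * mu * t / k ^+ 2) = t * (N * mu / k) by move=> ?; field.
rewrite -[leRHS]mul1r.
apply: le_trans (@matrix_bernstein R 'I_(n ^ 2) K 1 p y ((N * mu / K%:R) ^+ 2 * t)
   (N * mu * t / K%:R ^+ 2) (4^-1 * t) T0 _ _ _ _ _ _ _); last first.
- rewrite aux1 //; have := ler_wpM2r (ltW t0) hp; rewrite -/N.
  by move: (N * mu / K%:R) (p.+1%:R : R) => r q; rewrite !expr2; lra.
- move=> u; under eq_avg do rewrite yuE mulrC; rewrite avgZ mulrC.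
  rewrite ler_wpM2r ?frob_ge0 //.
  have h : \sum_a c a ^+ 2 <= (N / K%:R) ^+ 2 * (mu * t).
    apply: (@le_trans _ _ ((N / K%:R) ^+ 2 * (\sum_a g a ^+ 2 * t))).
      rewrite mulr_sumr; apply: ler_sum => a _; rewrite /c exprMn ler_wpM2l ?sqr_ge0 //.
      by rewrite exprMn ler_wpM2l ?sqr_ge0.
    by rewrite ler_wpM2l ?sqr_ge0 // -mulr_suml ler_wpM2r // ltW.
  rewrite /avg card_ord -/N.
  have aux (M k m s : R) : M != 0 -> k != 0 -> (M / k) ^+ 2 * (m * s) / M = M * m * s / k ^+ 2.
    by move=> M0 kk0; field; rewrite kk0 M0.
  by rewrite -(aux N K%:R mu t) // ler_wpM2r // invr_ge0.
- move=> a u; rewrite yuE ler_wpM2r ?frob_ge0 // /c.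
  have -> : (N * mu / K%:R) ^+ 2 * t = (N / K%:R) ^+ 2 * (mu * mu * t).
    by move: K%:R^-1 => k; ring.
  rewrite exprMn ler_wpM2l ?sqr_ge0 // exprMn.
  by apply: ler_pM; rewrite ?sqr_ge0.
- by move=> a; rewrite /y tr_scalar_mx.
- by rewrite mulr_gt0.
- by rewrite divr_ge0 ?mulr_ge0 ?exprn_ge0 // ltW.
- by rewrite mulr_ge0 ?sqr_ge0 // ltW.
apply: prb_le => w; apply: contra_not => h; have := h 1%:M; lazy zeta.
have sumM (I : finType) (F : I -> R) : \sum_i ((F i)%:M : 'M[R]_1) = (\sum_i F i)%:M.
  by apply/matrixP => i j; rewrite summxE !ord1 !mxE !mulr1n; apply: eq_bigr => k _; rewrite !mxE.
have -> : draw_sum y w - K%:R *: mxavg y =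
    - (frob (X b) (Z - tproj P (batch_op X w Z)))%:M.
  rewrite frobBr raddfB opprB; congr (_ - _).
    rewrite /draw_sum /y sumM /batch_op tprojZ tproj_sum frobZr frob_sumr mulr_sumr.
    congr (_%:M); apply: eq_bigr => k _; rewrite tprojZ frobZr /c /g.
    by rewrite [frob (X b) _ * _]mulrC.
  rewrite /mxavg /y sumM card_ord scalerA scale_scalar_mx; congr (_%:M).
  rewrite -[in RHS]ZT [in RHS](basis_expand Z oX) tproj_sum frob_sumr mulr_sumr.
  by apply: eq_bigr => a _; rewrite tprojZ frobZr /c mulr_mean_cancel // mulrC.
rewrite mulNmx frobNl frobNr opprK mul_scalar_mx frobZl frobZr.
have -> : frob (1%:M : 'cV[R]_1) 1%:M = 1.
  by rewrite frobE trmx1 mulmx1 mxtrace1.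
by rewrite !mulr1 -expr2.
Qed.

(** s is the current scale, 1 at sgn A. [c1] stands for the operator norm alternative of coherence;
    otherwise the coordinate bound on sgn A is propagated, rescaled by s. *)
Definition golf_inv (R : realType) (n r : nat) (X : 'I_(n ^ 2) -> 'M[R]_n) (P : 'M[R]_n)
    (nu : R) (c1 : Prop) (s : R) (Z : 'M[R]_n) : Prop :=
  [/\ 0 < s, tproj P Z = Z, frob Z Z <= s ^+ 2 * r%:R &
     c1 \/ forall a, frob (X a) Z ^+ 2 <= s ^+ 2 * (nu * r%:R / n%:R ^+ 2)].

Definition golf_ok (R : realType) (n r K : nat) (X : 'I_(n ^ 2) -> 'M[R]_n) (P : 'M[R]_n)
    (nu : R) (c1 : Prop) (s : R) (Z : 'M[R]_n) (w : {ffun 'I_K -> 'I_(n ^ 2)}) : Prop :=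
  [/\ forall Y, tproj P Y = Y ->
        frob (Y - tproj P (batch_op X w Y)) (Y - tproj P (batch_op X w Y)) <= 4^-1 * frob Y Y,
      forall u : 'cV[R]_n, frob (nproj P (batch_op X w Z) *m u) (nproj P (batch_op X w Z) *m u)
        <= s ^+ 2 / 16 * frob u u &
      c1 \/ forall b, frob (X b) (Z - tproj P (batch_op X w Z)) ^+ 2
        <= 4^-1 * (s ^+ 2 * (nu * r%:R / n%:R ^+ 2))].

Lemma golf_step (R : realType) (n r K : nat) (X : 'I_(n ^ 2) -> 'M[R]_n) (P : 'M[R]_n)
    (nu : R) (c1 : Prop) (s : R) (Z : 'M[R]_n) (w : {ffun 'I_K -> 'I_(n ^ 2)}) :
  P *m P = P -> golf_inv r X P nu c1 s Z -> golf_ok r X P nu c1 s Z w ->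
  golf_inv r X P nu c1 (s / 2) (Z - tproj P (batch_op X w Z)).
Proof.
move=> PP [s0 ZT Zs hc] [h1 h2 h3]; split.
- by rewrite divr_gt0.
- by rewrite -{1}ZT -[X in X = _]/(tproj P (_ - _)); move: (batch_op _ _ _) => Y;
    rewrite !tprojE !nprojB !nproj_id // !subrr !subr0 -tprojE ZT.
- by apply: (le_trans (h1 Z ZT)); rewrite expr_div_n; lra.
case: h3 => h3; [by left|right] => a; apply: (le_trans (h3 a)).
by rewrite expr_div_n; lra.
Qed.

(** With x = (p+1) rho <= 1/512, the contraction and coordinate events ask for 32x + 256x^2 <= 1/4
    and the normal event for 16x + 128x^2 <= 1/16. The dimensions n^2, 2n and n^2 of the three
    bounds add up to at most 4n^2. *)
Lemma prb_golf_fail (R : realType) (n r K p : nat) (X : 'I_(n ^ 2) -> 'M[R]_n)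
    (P : 'M[R]_n) (nu s : R) (c1 : Prop) (Z : 'M[R]_n) :
  (0 < n)%N -> (0 < K)%N -> (0 < r)%N -> orthonormal_basis X -> P^T = P -> P *m P = P ->
  1 <= nu ->
  (forall a, frob (tproj P (X a)) (tproj P (X a)) <= 2 * nu * r%:R / n%:R) ->
  (c1 -> forall a (u : 'cV[R]_n), frob (X a *m u) (X a *m u) <= nu / n%:R * frob u u) ->
  512 * p.+1%:R * (n%:R * nu * r%:R / K%:R) <= 1 ->
  golf_inv r X P nu c1 s Z ->
  prb R (fun w : {ffun 'I_K -> 'I_(n ^ 2)} => ~ golf_ok r X P nu c1 s Z w)
    <= 4 * (n ^ 2)%:R * 4^-1 ^+ p.+1.
Proof.
move=> n0 K0 r0 oX sP PP nu1 hmu hc1 hp [s0 ZT Zs hc].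
set rho := n%:R * nu * r%:R / K%:R in hp.
have n0' : n%:R != 0 :> R by exact: natr_neq0.
have k0 : K%:R != 0 :> R by exact: natr_neq0.
have r1 : 1 <= r%:R :> R by rewrite ler1n.
have nu0 : 0 < nu by lra.
have np : 0 < n%:R :> R by rewrite ltr0n.
have kp : 0 < K%:R :> R by rewrite ltr0n.
have rho0 : 0 <= rho by rewrite /rho divr_ge0 ?mulr_ge0 // ltW.
have mu0 : 0 <= 2 * nu * r%:R / n%:R by rewrite divr_ge0 ?mulr_ge0 // ltW.
have NmuK : (n ^ 2)%:R * (2 * nu * r%:R / n%:R) / K%:R = 2 * rho.
  by rewrite /rho natrX; field; rewrite n0' k0.
have x0 : 0 <= p.+1%:R * rho by rewrite mulr_ge0.
have hx : p.+1%:R * rho <= 512^-1 by lra.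
have x2 : (p.+1%:R * rho) * (p.+1%:R * rho) <= 512^-1 * 512^-1 by apply: ler_pM.
have thr : 16 * p.+1%:R * ((n ^ 2)%:R * (2 * nu * r%:R / n%:R) / K%:R +
    p.+1%:R * (4 * ((n ^ 2)%:R * (2 * nu * r%:R / n%:R) / K%:R) ^+ 2)) <= 4^-1.
  rewrite NmuK !expr2; move: x2 hx x0; lra.
have Ea := @batch_contraction R n K p X P _ n0 K0 oX sP PP mu0 hmu thr.
have s2 : 0 < s ^+ 2 by rewrite exprn_gt0.
have Eb : prb R (fun w : {ffun 'I_K -> 'I_(n ^ 2)} => ~ (forall u : 'cV[R]_n,
    frob (nproj P (batch_op X w Z) *m u) (nproj P (batch_op X w Z) *m u) <= s ^+ 2 / 16 * frob u u))
    <= (n + n)%:R * 4^-1 ^+ p.+1.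
  (* The same B and V serve both alternatives. Under [c1], <X_a, Z>^2 <= (2 nu r/n) s^2 r and
     |X_a|^2 <= nu/n; otherwise the coordinate bound is combined with |X_a| <= 1, using nu r >= 1
     for B and the basis identity for V. *)
  apply: (@batch_normal R n K p X P Z (2 * rho ^+ 2 * s ^+ 2) (nu * r%:R * s ^+ 2 / n%:R)) => //.
  - by apply: mulr_ge0; [apply: mulr_ge0 => //|]; exact: sqr_ge0.
  - by rewrite divr_ge0 // mulr_ge0 ?(ltW s2) // mulr_ge0 // ltW.
  - by rewrite divr_gt0.
  - move=> a u; have [c|c] := pselect c1.
      have q2 : frob (X a) Z ^+ 2 <= 2 * nu * r%:R / n%:R * (s ^+ 2 * r%:R).
        rewrite -ZT -frob_tprojl //; apply: (le_trans (frob_cauchy _ _)).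
        by apply: ler_pM; rewrite ?frob_ge0.
      have -> : 2 * rho ^+ 2 * s ^+ 2 * frob u u = ((n ^ 2)%:R / K%:R) ^+ 2 *
          ((2 * nu * r%:R / n%:R * (s ^+ 2 * r%:R)) * (nu / n%:R * frob u u)).
        by rewrite /rho natrX; field; rewrite n0' k0.
      rewrite -mulrA ler_wpM2l ?sqr_ge0 //.
      by apply: ler_pM; rewrite ?sqr_ge0 ?frob_ge0 //; exact: hc1.
    have q2 : frob (X a) Z ^+ 2 <= s ^+ 2 * (nu * r%:R / n%:R ^+ 2).
      by case: hc => // ->.
    have Xu : frob (X a *m u) (X a *m u) <= frob u u.
      by apply: (le_trans (frob_mul_le _ _)); have [_ ->] := oX; rewrite eqxx mul1r.
    apply: (@le_trans _ _ (((n ^ 2)%:R / K%:R) ^+ 2 *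
          ((s ^+ 2 * (nu * r%:R / n%:R ^+ 2)) * frob u u))).
      rewrite -mulrA ler_wpM2l ?sqr_ge0 //.
      by apply: ler_pM; rewrite ?sqr_ge0 ?frob_ge0.
    rewrite [leLHS]mulrA ler_wpM2r ?frob_ge0 //.
    have -> : ((n ^ 2)%:R / K%:R) ^+ 2 * (s ^+ 2 * (nu * r%:R / n%:R ^+ 2)) =
        (n%:R / K%:R) ^+ 2 * s ^+ 2 * (nu * r%:R).
      by rewrite natrX; field; rewrite n0' k0.
    have -> : 2 * rho ^+ 2 * s ^+ 2 = (n%:R / K%:R) ^+ 2 * s ^+ 2 * (2 * (nu * r%:R) ^+ 2).
      by rewrite /rho; field.
    rewrite ler_wpM2l //; first by rewrite mulr_ge0 ?sqr_ge0.
    have nr1 : 1 <= nu * r%:R by rewrite -[leLHS]mulr1 ler_pM.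
    by rewrite expr2; nra.
  - move=> u; have [c|c] := pselect c1.
      apply: (@le_trans _ _ (\sum_a frob (X a) Z ^+ 2 * (nu / n%:R * frob u u))).
        by apply: ler_sum => a _; rewrite ler_wpM2l ?sqr_ge0 //; exact: hc1.
      rewrite -mulr_suml; under eq_bigr do rewrite expr2; rewrite parseval //.
      have -> : nu * r%:R * s ^+ 2 / n%:R * frob u u = s ^+ 2 * r%:R * (nu / n%:R * frob u u).
        by ring.
      by rewrite ler_wpM2r // mulr_ge0 ?frob_ge0 // divr_ge0 // ltW.
    apply: (@le_trans _ _ (\sum_a s ^+ 2 * (nu * r%:R / n%:R ^+ 2) * frob (X a *m u) (X a *m u))).
      by apply: ler_sum => a _; rewrite ler_wpM2r ?frob_ge0 //; case: hc => // ->.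
    rewrite -mulr_sumr sum_frob_basis // le_eqVlt; apply/orP; left; apply/eqP.
    by field.
  - move=> u; have [c|c] := pselect c1.
      have nun : 0 <= nu / n%:R by rewrite divr_ge0 // ltW.
      apply: (@le_trans _ _ (\sum_a frob (X a) Z ^+ 2 * (nu / n%:R * frob u u))).
        apply: ler_sum => a _; rewrite ler_wpM2l ?sqr_ge0 //.
        exact: (opnorm_trmx nun (hc1 c a)).
      rewrite -mulr_suml; under eq_bigr do rewrite expr2; rewrite parseval //.
      have -> : nu * r%:R * s ^+ 2 / n%:R * frob u u = s ^+ 2 * r%:R * (nu / n%:R * frob u u).
        by ring.
      by rewrite ler_wpM2r // mulr_ge0 ?frob_ge0.
    apply: (@le_trans _ _ (\sum_a s ^+ 2 * (nu * r%:R / n%:R ^+ 2) * frob ((X a)^T *m u) ((X a)^T *m u))).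
      by apply: ler_sum => a _; rewrite ler_wpM2r ?frob_ge0 //; case: hc => // ->.
    rewrite -mulr_sumr sum_frob_basis_tr // le_eqVlt; apply/orP; left; apply/eqP.
    by field.
  have -> : (n ^ 2)%:R * (nu * r%:R * s ^+ 2 / n%:R) / K%:R = rho * s ^+ 2.
    by rewrite /rho natrX; field; rewrite n0' k0.
  have -> : 16 * p.+1%:R * (rho * s ^+ 2 + p.+1%:R * (4 * (2 * rho ^+ 2 * s ^+ 2))) =
     s ^+ 2 * (16 * (p.+1%:R * rho) + 128 * (p.+1%:R * rho * (p.+1%:R * rho))) by ring.
  by rewrite ler_wpM2l ?sqr_ge0 //; lra.
have q0 : 0 <= 4^-1 ^+ p.+1 :> R by rewrite exprn_ge0.
have Ec : prb R (fun w : {ffun 'I_K -> 'I_(n ^ 2)} => ~ (c1 \/ forall b,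
    frob (X b) (Z - tproj P (batch_op X w Z)) ^+ 2
        <= 4^-1 * (s ^+ 2 * (nu * r%:R / n%:R ^+ 2)))) <= (n ^ 2)%:R * 4^-1 ^+ p.+1.
  have [c|c] := pselect c1.
    rewrite /prb (eq_avg (g := fun=> 0)) => [|w].
      rewrite avg_cst ?mulr_ge0 // card_ffun expn_gt0 card_ord expn_gt0 n0 //.
    by case: asboolP => // -[]; left.
  have t0 : 0 < s ^+ 2 * (nu * r%:R / n%:R ^+ 2).
    by rewrite mulr_gt0 ?divr_gt0 ?mulr_gt0 ?exprn_gt0 // (lt_le_trans _ r1).
  have ht a : frob (X a) Z ^+ 2 <= s ^+ 2 * (nu * r%:R / n%:R ^+ 2) by case: hc => // ->.
  have := prb_exists (fun b => @batch_coord R n K p X P Z _ _ b n0 K0 oX sP PP ZT mu0 t0 hmu ht thr).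
  rewrite card_ord; apply: le_trans; apply: prb_le => w h.
  by apply: contra_notP h => /forallNP h; right => b; apply: contrapT; exact: h.
apply: (@le_trans _ _ ((n ^ 2)%:R * 4^-1 ^+ p.+1 + ((n + n)%:R * 4^-1 ^+ p.+1
   + (n ^ 2)%:R * 4^-1 ^+ p.+1))).
  apply: le_trans (lerD Ea (lerD Eb Ec)).
  set E1 := (X in prb R X + _ ); set E2 := (X in _ + (prb R X + _)).
  set E3 := (X in _ + (_ + prb R X)).
  apply: (@le_trans _ _ (prb R (fun w => E1 w \/ (E2 w \/ E3 w)))).
    apply: prb_le => w h; have [h1|] := pselect (~ E1 w); last by left; apply: contrapT.
    right; have [h2|] := pselect (~ E2 w); last by left; apply: contrapT.
    by right => h3; apply: h; split=> //; apply: contrapT.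
  by apply: (le_trans (prb_or _ _ _)); rewrite lerD2l prb_or.
rewrite -!mulrDl ler_wpM2r // -!natrD -natrM ler_nat.
have h : (n <= n ^ 2)%N by rewrite -{1}(expn1 n) leq_pexp2l.
by rewrite !mulSn mul0n addn0 leq_add2l addnA leq_add2r leq_add.
Qed.

(** * Golfing *)

(** Each batch is judged at the state produced by the batches before it. *)
Fixpoint chain (B St : Type) (ok : St -> B -> Prop) (step : St -> B -> St) (st : St)
    (ws : seq B) : Prop :=
  if ws is w :: ws' then ok st w /\ chain ok step (step st w) ws' else True.

Lemma avg_tuple_cons (R : realType) (B : finType) (L : nat) (f : L.+1.-tuple B -> R) :
  avg f = avg (fun w => avg (fun t : L.-tuple B => f [tuple of w :: t])).
Proof.
rewrite /avg -mulr_suml pair_bigA /= card_tuple expnS natrM invfM.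
rewrite [X in _ * X]mulrC mulrA card_tuple; congr (_ / _ / _).
rewrite (reindex (fun p : B * L.-tuple B => [tuple of p.1 :: p.2])) //=.
apply: onW_bij; exists (fun t : L.+1.-tuple B => (thead t, behead_tuple t)).
  by move=> [w t] /=; congr (_, _); apply/val_inj.
by move=> t /=; rewrite [in RHS](tuple_eta t); apply/val_inj.
Qed.

(** Fix the first draw: either it fails, with probability at most d, or the remaining independent
    draws start from a state that satisfies the invariant. The uniformity of d over such states
    replaces conditioning. *)
Lemma prb_chain_fail (R : realType) (B : finType) (St : Type) (inv : St -> Prop)
    (ok : St -> B -> Prop) (step : St -> B -> St) (d : R) (L : nat) (st : St) :
  (0 < #|B|)%N -> 0 <= d ->
  (forall st w, inv st -> ok st w -> inv (step st w)) ->
  (forall st, inv st -> prb R (fun w => ~ ok st w) <= d) ->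
  inv st -> prb R (fun ws : L.-tuple B => ~ chain ok step st ws) <= L%:R * d.
Proof.
move=> B0 d0 hstep hok; elim: L st => [|L IH] st hst.
  have T0 : (0 < #|{: 0.-tuple B}|)%N by rewrite card_tuple.
  rewrite mul0r -(avg_cst 0 T0); apply: avg_le => t.
  by rewrite tuple0; case: asboolP => //= h; exfalso; apply: h.
rewrite /prb avg_tuple_cons -natr1 mulrDl mul1r addrC.
have T0 : (0 < #|{: L.-tuple B}|)%N by rewrite card_tuple expn_gt0 B0.
apply: (@le_trans _ _ (prb R (fun w => ~ ok st w) + L%:R * d)); last by rewrite lerD2r hok.
rewrite -[X in _ + X](avg_cst _ B0) /prb -avgD; apply: avg_le => w.
case: asboolP => [_|/contrapT okw].
  apply: (@le_trans _ _ 1); last by rewrite lerDl mulr_ge0.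
  rewrite -[X in _ <= X](avg_cst _ T0); apply: avg_le => t.
  by rewrite -[X in _ <= X](mulr1n 1) ler_nat; case: asboolP.
rewrite add0r; apply: le_trans (IH (step st w) (hstep _ _ hst okw)).
apply: prb_le => t /= h; apply: contra_not h => h; split=> //.
Qed.

Definition golf_update (R : realType) (n K : nat) (X : 'I_(n ^ 2) -> 'M[R]_n) (P : 'M[R]_n)
    (st : R * 'M[R]_n) (w : {ffun 'I_K -> 'I_(n ^ 2)}) : R * 'M[R]_n :=
  (st.1 / 2, st.2 - tproj P (batch_op X w st.2)).

Lemma frob_batch_op (R : realType) (n K : nat) (X : 'I_(n ^ 2) -> 'M[R]_n)
    (w : {ffun 'I_K -> 'I_(n ^ 2)}) (Z H : 'M[R]_n) :
  frob (batch_op X w Z) H =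
  (n ^ 2)%:R / K%:R * \sum_k frob (X (w k)) Z * frob (X (w k)) H.
Proof.
by rewrite /batch_op frobZl frob_suml; congr (_ * _); apply: eq_bigr => k _; rewrite frobZl.
Qed.

(** Y is R Z plus the certificate built for the residual Z - P_T R Z, so the tangential error
    telescopes to the last residual. *)
Lemma golf_dual (R : realType) (n r K : nat) (X : 'I_(n ^ 2) -> 'M[R]_n) (P : 'M[R]_n)
    (nu : R) (c1 : Prop) (ws : seq {ffun 'I_K -> 'I_(n ^ 2)}) (s : R) (Z : 'M[R]_n) :
  P *m P = P -> golf_inv r X P nu c1 s Z ->
  chain (fun st => golf_ok r X P nu c1 st.1 st.2) (golf_update X P) (s, Z) ws ->
  exists Y : 'M[R]_n,
    [/\ forall H : 'M[R]_n, (forall w k, w \in ws -> frob (X (w k)) H = 0) -> frob Y H = 0,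
        frob (Z - tproj P Y) (Z - tproj P Y) <= (s / 2 ^+ size ws) ^+ 2 * r%:R &
        forall u : 'cV[R]_n, frob (nproj P Y *m u) (nproj P Y *m u) <= s ^+ 2 / 4 * frob u u].
Proof.
move=> PP; elim: ws s Z => [|w ws IH] s Z hinv /=.
  move=> _; exists 0; case: hinv => s0 _ hZ _; split.
  - by move=> H _; rewrite frob0l.
  - by rewrite tproj0 subr0 expr0 divr1.
  - move=> u; rewrite /nproj mulmx0 mul0mx mul0mx frob0l.
    by rewrite mulr_ge0 ?frob_ge0 // divr_ge0 // sqr_ge0.
move=> [hok hch].
have [Y [hY hE hN]] := IH _ _ (golf_step PP hinv hok) hch.
exists (batch_op X w Z + Y); split.
- move=> H hH; rewrite frobDl hY => [|w' k w'ws]; last by rewrite hH // in_cons w'ws orbT.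
  rewrite frob_batch_op big1 ?mulr0 ?addr0 // => k _.
  by rewrite (hH w k) ?mem_head // mulr0.
- have -> : s / 2 ^+ (size ws).+1 = s / 2 / 2 ^+ size ws by rewrite exprS invfM mulrA.
  by rewrite tprojD opprD addrA.
(* Both parts have squared norm at most s^2/16: the first by [golf_ok], the second by induction at
   scale s/2. Then |a + b|^2 <= 2|a|^2 + 2|b|^2 restores s^2/4. *)
- move=> u; case: hok => _ /(_ u) h _; have := hN u; rewrite expr_div_n.
  rewrite nprojD mulmxDl; set a := nproj P (batch_op X w Z) *m u in h *.
  set b := nproj P Y *m u; have := frob_ge0 (a - b).
  rewrite !(frobBl, frobBr, frobDl, frobDr) (frobC b a).
  have := frob_ge0 u; move: h; move: (frob a a) (frob a b) (frob b b) (frob u u) => x y z v.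
  move: (s ^+ 2) => s2; lra.
Qed.

(* On the draws the coordinates of the tangential and normal parts of H are opposite. *)
Lemma batch_injective (R : realType) (n K : nat) (X : 'I_(n ^ 2) -> 'M[R]_n) (P : 'M[R]_n)
    (w : {ffun 'I_K -> 'I_(n ^ 2)}) (H : 'M[R]_n) :
  (0 < K)%N -> orthonormal_basis X -> P^T = P -> P *m P = P ->
  (forall Y, tproj P Y = Y ->
    frob (Y - tproj P (batch_op X w Y)) (Y - tproj P (batch_op X w Y)) <= 4^-1 * frob Y Y) ->
  (forall k, frob (X (w k)) H = 0) ->
  frob (tproj P H) (tproj P H) <= 2 * (n ^ 2)%:R * frob (nproj P H) (nproj P H).
Proof.
move=> K0 oX sP PP hc hH; have := hc _ (tproj_id H PP).
have k0 : K%:R != 0 :> R by exact: natr_neq0.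
set T := tproj P H; set E := T - _ => hE.
have TT : frob T T = frob (batch_op X w T) T + frob E T.
  have -> : frob (batch_op X w T) T = frob (tproj P (batch_op X w T)) T.
    by rewrite frob_tprojl // tproj_id.
  by rewrite /E frobBl; ring.
have hB : frob (batch_op X w T) T <= (n ^ 2)%:R * frob (nproj P H) (nproj P H).
  rewrite frob_batch_op.
  apply: (@le_trans _ _ ((n ^ 2)%:R / K%:R * \sum_(k < K) frob (nproj P H) (nproj P H))).
    rewrite ler_wpM2l ?divr_ge0 //; apply: ler_sum => k _.
    have -> : frob (X (w k)) T = - frob (X (w k)) (nproj P H).
      by rewrite /T tprojE frobBr hH sub0r.
    rewrite mulrNN -expr2; apply: (le_trans (frob_cauchy _ _)).
    by have [_ ->] := oX; rewrite eqxx mul1r.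
  rewrite sumr_const card_ord -[frob _ _ *+ K]mulr_natl mulrA divfK //.
(* With |E|^2 <= |T|^2/4 this costs half of |T|^2, hence the factor 2 in the conclusion. *)
have h : frob E T <= 4^-1 * frob T T + frob E E.
  move: T E {TT hE hB} => T E; have := frob_ge0 (2^-1 *: T - E).
  by rewrite !(frobBl, frobBr, frobZl, frobZr) (frobC T E); lra.
by lra.
Qed.

(** The certificate is used with e = r/4^L, for L batches, and d = 2n^2, so that 4ed < 1 reads 8 n^2
    r < 4^L. *)
Lemma golf_recovery (R : realType) (n r K : nat) (A : 'M[R]_n) (X : 'I_(n ^ 2) -> 'M[R]_n)
    (nu : R) (c1 : Prop) (ws : seq {ffun 'I_K -> 'I_(n ^ 2)}) (Omega : {set 'I_(n ^ 2)}) :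
  let P := range_proj A in
  A^T = A -> (0 < K)%N -> orthonormal_basis X -> (0 < size ws)%N ->
  8 * (n ^ 2)%:R * r%:R < (2 ^+ size ws) ^+ 2 :> R ->
  golf_inv r X P nu c1 1 (sgnmx A) ->
  chain (fun st => golf_ok r X P nu c1 st.1 st.2) (golf_update X P) (1, sgnmx A) ws ->
  (forall w k, w \in ws -> w k \in Omega) ->
  forall Z : 'M[R]_n, is_minimizer A X Omega Z <-> Z = A.
Proof.
move=> P sA K0 oX ws0 hL hinv hch hO.
have [[sP PP _ _] _] := sym_polar sA.
have [Y [hY hE hN]] := golf_dual PP hinv hch.
have hvan (H : 'M[R]_n) : (forall a, a \in Omega -> frob (X a) H = 0) ->
    forall w k, w \in ws -> frob (X (w k)) H = 0.
  by move=> h w k wws; apply: h; exact: hO.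
have hinj (H : 'M[R]_n) : (forall a, a \in Omega -> frob (X a) H = 0) ->
    frob (tproj P H) (tproj P H) <= 2 * (n ^ 2)%:R * frob (nproj P H) (nproj P H).
  (* The contraction property of the first batch alone controls the tangential part. *)
  move=> /hvan; case: ws ws0 hch {hL hE hY hO hvan} => // w ws _ /= [[h _ _] _] hv.
  by apply: (batch_injective K0 oX sP PP h) => k; apply: hv; rewrite mem_head.
apply: (@dual_certificate R n A X Omega Y ((1 / 2 ^+ size ws) ^+ 2 * r%:R) (2 * (n ^ 2)%:R)) => //.
- rewrite expr_div_n expr1n div1r.
  have L0 : 0 < (2 ^+ size ws) ^+ 2 :> R by rewrite !exprn_gt0.
  rewrite -(ltr_pM2r L0) mul1r; apply: le_lt_trans hL; rewrite le_eqVlt; apply/orP; left; apply/eqP.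
  by field; rewrite gt_eqF ?exprn_gt0.
- by move=> H /hvan; exact: hY.
- by move=> u; have := hN u; rewrite expr1n div1r.
Qed.

(** * From draws to random subsets *)

(** List A followed by its complement, and B followed by its complement; matching positions defines
    the permutation. *)
Lemma perm_imset_exists (T : finType) (A B : {set T}) :
  #|A| = #|B| -> exists s : {perm T}, s @: A = B.
Proof.
move=> AB; pose e (C : {set T}) := enum C ++ enum (~: C).
have eu C : uniq (e C).
  rewrite cat_uniq !enum_uniq andbT /=; apply/hasPn => x.
  by rewrite !mem_enum inE.
have em C x : x \in e C by rewrite mem_cat !mem_enum inE orbN.
have es C : size (e C) = #|T| by rewrite size_cat -!cardE cardsC.
case: (pickP T) => [x0 _|T0]; last first.
  by exists 1%g; apply/setP => x; have := T0 x.
pose f x := nth x0 (e B) (index x (e A)).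
have fI : injective f.
  move=> x y /eqP; rewrite /f nth_uniq ?es //; try by rewrite -(es A) index_mem.
  by move=> /eqP h; rewrite -(nth_index x0 (em A x)) h nth_index.
exists (perm fI); apply/eqP; rewrite eqEcard card_imset; last exact: perm_inj.
rewrite AB leqnn andbT; apply/fintype.subsetP => _ /imsetP [x xA ->].
rewrite permE /f /e index_cat mem_enum xA nth_cat -cardE -AB cardE index_mem mem_enum xA.
by rewrite -mem_enum mem_nth // -cardE -AB cardE index_mem mem_enum.
Qed.

Lemma superset_of_card (T : finType) (A : {set T}) (m : nat) :
  (#|A| <= m <= #|T|)%N -> exists2 B : {set T}, A \subset B & #|B| = m.
Proof.
elim: m => [|m IH] /andP [Am mT].
  by exists A => //; apply/eqP; rewrite -leqn0.
move: Am; rewrite leq_eqVlt => /orP [/eqP Am|]; first by exists A.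
rewrite ltnS => Am; have [|B AB Bm] := IH; first by rewrite Am ltnW.
have /card_gt0P [x] : (0 < #|~: B|)%N by rewrite cardsCs finset.setCK Bm subn_gt0.
rewrite inE => xB; exists (x |: B); last by rewrite cardsU1 xB Bm.
by apply: (fintype.subset_trans AB); rewrite finset.subsetUr.
Qed.

(** Permutations act transitively on the m-subsets, so a uniformly permuted copy of one fixed
    m-subset is a uniform m-subset. *)
Lemma prob_subset_perm (R : realType) (N m : nat) (G : {set 'I_N} -> Prop) (Om : {set 'I_N}) :
  #|Om| = m ->
  prob_subset R m G = prb R (fun s : {perm 'I_N} => G (s @: Om)).
Proof.
move=> Omm; pose f (O : {set 'I_N}) : R := (`[< G O >] : nat)%:R.
pose c (O : {set 'I_N}) := avg (fun s : {perm 'I_N} => f (s @: O)).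
have P0 : (0 < #|{: {perm 'I_N}}|)%N by apply/card_gt0P; exists 1%g.
have cE (O : {set 'I_N}) : #|O| = m -> c O = c Om.
  move=> Om'; have [s0 <-] := perm_imset_exists (etrans Omm (esym Om')).
  rewrite /c /avg; congr (_ / _); rewrite [RHS](reindex_inj (mulgI s0)) /=.
  apply: eq_bigr => s _; congr f; rewrite -imset_comp; apply: eq_imset => x /=.
  by rewrite permM.
have inv (s : {perm 'I_N}) : \sum_(O : {set 'I_N} | #|O| == m) f O =
    \sum_(O : {set 'I_N} | #|O| == m) f (s @: O).
  rewrite (reindex_inj (imset_inj (@perm_inj _ s))) /=; apply: eq_bigl => O.
  by rewrite card_imset //; exact: perm_inj.
have sumE : \sum_(O : {set 'I_N} | #|O| == m) f O = #|[pred O : {set 'I_N} | #|O| == m]|%:R * c Om.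
  transitivity (avg (fun s : {perm 'I_N} => \sum_(O : {set 'I_N} | #|O| == m) f (s @: O))).
    by rewrite -[LHS](avg_cst _ P0); apply: eq_avg => s; exact: inv.
  rewrite /avg exchange_big mulr_suml /= mulr_natl -[in RHS]sumr_const.
  by apply: eq_big => [B|B /eqP /cE <-]; rewrite ?inE.
rewrite /prob_subset -/(c Om).
have -> : #|[pred O : {set 'I_N} | (#|O| == m) && `[< G O >]]|%:R =
    \sum_(O : {set 'I_N} | #|O| == m) f O.
  rewrite -sum1_card natr_sum big_mkcondr /=; apply: eq_bigr => O _; rewrite /f.
  by case: `[< _ >].
rewrite sumE mulrAC divff ?mul1r // pnatr_eq0 -lt0n; apply/card_gt0P.
by exists Om; rewrite inE Omm.
Qed.

(* Both laws are invariant under permutations of the index set, so that the range of a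
   random draw can be compared with an m-subset containing it. *)
Lemma prb_draw_le_subset (R : realType) (N m : nat) (D : finType) (im : D -> {set 'I_N})
    (act : {perm 'I_N} -> D -> D) (G : {set 'I_N} -> Prop) :
  (0 < #|D|)%N -> (m <= N)%N -> (forall s, injective (act s)) ->
  (forall s d, im (act s d) = s @: im d) -> (forall d, #|im d| <= m)%N ->
  (forall O O' : {set 'I_N}, O \subset O' -> G O -> G O') ->
  prb R (fun d => G (im d)) <= prob_subset R m G.
Proof.
move=> D0 mN actI imE imm Gmon.
have P0 : (0 < #|{: {perm 'I_N}}|)%N by apply/card_gt0P; exists 1%g.
have -> : prb R (fun d => G (im d)) =
    avg (fun d => prb R (fun s : {perm 'I_N} => G (s @: im d))).
  rewrite /prb avgC -[LHS](avg_cst _ P0); apply: eq_avg => s.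
  rewrite /avg; congr (_ / _); rewrite (reindex_inj (actI s)) /=.
  by apply: eq_bigr => d _; rewrite imE.
rewrite -[leRHS](avg_cst _ D0); apply: avg_le => d.
have [|O imO Om] := @superset_of_card _ (im d) m; first by rewrite imm card_ord.
by rewrite (prob_subset_perm _ _ Om); apply: prb_le => s; apply: Gmon; exact: imsetS.
Qed.

(** * Choice of parameters *)

Lemma frob_sum_col (R : realType) (m n : nat) (B : 'M[R]_(m, n)) :
  frob B B = \sum_j frob (col j B) (col j B).
Proof.
rewrite {1}/frob exchange_big /=; apply: eq_bigr => j _; rewrite frob_colE.
by apply: eq_bigr => i _; rewrite mxE expr2.
Qed.

Lemma frob_opnorm_le (R : realType) (m n p : nat) (M : 'M[R]_(m, n)) (B : 'M[R]_(n, p)) (c : R) :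
  (forall u : 'cV[R]_n, frob (M *m u) (M *m u) <= c * frob u u) ->
  frob (M *m B) (M *m B) <= c * frob B B.
Proof.
move=> hM; rewrite !frob_sum_col mulr_sumr; apply: ler_sum => j _.
by rewrite colE -mulmxA -colE.
Qed.

(** P_T X is the orthogonal sum of PX and (1 - P)XP, each of squared norm at most c tr P. Thus the
    first coherence alternative implies the tangential bound of the second. *)
Lemma frob_tproj_opnorm (R : realType) (n : nat) (P X : 'M[R]_n) (c : R) :
  0 <= c -> P^T = P -> P *m P = P ->
  (forall u : 'cV[R]_n, frob (X *m u) (X *m u) <= c * frob u u) ->
  frob (tproj P X) (tproj P X) <= 2 * c * \tr P.
Proof.
move=> c0 sP PP hX; have fP : frob P P = \tr P by rewrite frobE sP PP.
have hPX : frob (P *m X) (P *m X) <= c * \tr P.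
  rewrite -frob_trmx trmx_mul sP -fP; apply: frob_opnorm_le; exact: opnorm_trmx.
have hXP : frob (X *m P) (X *m P) <= c * \tr P by rewrite -fP; exact: frob_opnorm_le.
have -> : tproj P X = P *m X + (X *m P - P *m X *m P) by rewrite /tproj addrA.
have PXP : frob (P *m X) (X *m P - P *m X *m P) = 0.
  rewrite frobC; set Y := X *m P - _.
  have -> : P *m X = P *m (P *m X) by rewrite mulmxA PP.
  rewrite frobC frob_mull sP /Y mulmxBr !mulmxA PP subrr frob0r //.
have hQ : frob (X *m P - P *m X *m P) (X *m P - P *m X *m P) <= frob (X *m P) (X *m P).
  have e : frob (P *m X *m P) (P *m X *m P) = frob (X *m P) (P *m X *m P).
    by rewrite -{1}mulmxA frob_mull sP !mulmxA PP.
  rewrite !(frobBl, frobBr) (frobC (P *m X *m P) (X *m P)) -e.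
  by have := frob_ge0 (P *m X *m P); lra.
move: PXP hQ; move: (X *m P - _) => Y PXP hQ.
by rewrite !(frobDl, frobDr) (frobC Y) PXP; lra.
Qed.

(** More constraints shrink the feasible set, which still contains A; any minimizer there ties with
    A and so is a minimizer for the smaller set of constraints. *)
Lemma recovery_monotone (R : realType) (n : nat) (A : 'M[R]_n) (X : 'I_(n ^ 2) -> 'M[R]_n)
    (O O' : {set 'I_(n ^ 2)}) :
  O \subset O' -> (forall Z, is_minimizer A X O Z <-> Z = A) ->
  forall Z, is_minimizer A X O' Z <-> Z = A.
Proof.
move=> /fintype.subsetP OO' h.
have fO Z : feasible A X O' Z -> feasible A X O Z by move=> f a /OO'; exact: f.
have [_ minA] : is_minimizer A X O A by apply/h.
move=> Z; split=> [[fZ mZ]|->].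
  apply/h; split; first exact: fO.
  by move=> Y fY; apply: le_trans (minA Y fY); apply: mZ => a _.
by split=> [a //|Y fY]; apply: minA; exact: fO.
Qed.

(** The maximum dominates the average over the n^2 basis elements: the |X_a e|^2 sum to n for a unit
    vector e, and the <X_a, sgn A>^2 sum to r. *)
Lemma coherence_ge1 (R : realType) (n r : nat) (A : 'M[R]_n) (X : 'I_(n ^ 2) -> 'M[R]_n)
    (nu : R) :
  A^T = A -> \rank A = r -> (0 < r)%N -> (0 < n)%N -> orthonormal_basis X ->
  has_coherence A X nu -> 1 <= nu.
Proof.
move=> sA rA r0 n0 oX; have np : 0 < n%:R :> R by rewrite ltr0n.
case=> [h|[_ h]].
  have := sum_frob_basis (delta_mx (Ordinal n0) 0 : 'cV[R]_n) oX.
  rewrite frob_delta_vec mulr1 => hs.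
  have : n%:R <= \sum_(a < n ^ 2) nu / n%:R.
    rewrite -[X in X <= _]hs; apply: ler_sum => a _; have := spectral_norm_bound (delta_mx (Ordinal n0) 0) (h a).
    by rewrite frob_delta_vec mulr1.
  rewrite sumr_const card_ord -[(nu / n%:R) *+ _]mulr_natl natrX.
  have -> : n%:R ^+ 2 * (nu / n%:R) = n%:R * nu by field; rewrite gt_eqF.
  by rewrite ler_pMr.
have [[_ _ _ trP] [sS SS _ _]] := sym_polar sA.
have fS : frob (sgnmx A) (sgnmx A) = r%:R by rewrite frobE sS SS trP rA.
have : r%:R <= \sum_(a < n ^ 2) nu * r%:R / n%:R ^+ 2.
  rewrite -[X in X <= _]fS -(parseval _ _ oX); apply: ler_sum => a _.
  by rewrite -expr2 -rA; exact: h.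
rewrite sumr_const card_ord -[(nu * _ / _) *+ _]mulr_natl natrX.
have -> : n%:R ^+ 2 * (nu * r%:R / n%:R ^+ 2) = r%:R * nu by field; rewrite gt_eqF.
by rewrite ler_pMr // ltr0n.
Qed.

(** * Numerical estimates and the final probability *)

Lemma ln2_ge_half (R : realType) : 2^-1 <= ln 2 :> R.
Proof.
rewrite -ler_expR lnK ?posrE //.
have := expR_ge1Dx (- 2^-1 : R); rewrite expRN => h.
have e0 := expR_gt0 (2^-1 : R).
have : 2^-1 * expR 2^-1 <= 1 :> R.
  rewrite -[leRHS](mulVf (lt0r_neq0 e0)) ler_wpM2r ?(ltW e0) //.
  by apply: le_trans h; lra.
lra.
Qed.

Lemma quarter_exp_le (R : realType) (p : nat) (x : R) :
  x <= p%:R -> 4^-1 ^+ p <= expR (- x).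
Proof.
move=> xp; have -> : 4^-1 = expR (- (2 * ln 2)) :> R.
  by rewrite expRN expRM_natl lnK ?posrE // -natrX.
rewrite -expRM_natl ler_expR; have := ln2_ge_half R; have : 0 <= p%:R :> R by [].
by nra.
Qed.

(** Relabelling the indices acts on draws by composition and moves their range accordingly; L
    batches of K draws hit at most L K <= m indices, so success of the draws transfers to
    m-subsets. *)
Lemma recovery_probability (R : realType) (n r : nat) (A : 'M[R]_n)
    (X : 'I_(n ^ 2) -> 'M[R]_n) (nu : R) (m L K p : nat) :
  A^T = A -> \rank A = r -> (1 <= r <= n)%N -> orthonormal_basis X ->
  has_coherence A X nu -> (m <= n ^ 2)%N ->
  (0 < L)%N -> (0 < K)%N -> (L * K <= m)%N ->
  8 * (n ^ 2)%:R * r%:R < (2 ^+ L) ^+ 2 :> R ->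
  512 * p.+1%:R * (n%:R * nu * r%:R / K%:R) <= 1 ->
  1 - L%:R * (4 * (n ^ 2)%:R * 4^-1 ^+ p.+1) <=
  prob_subset R m (fun Omega => forall Z : 'M[R]_n, is_minimizer A X Omega Z <-> Z = A).
Proof.
move=> sA rA /andP [r0 rn] oX coh mn L0 K0 LK hL hp.
have n0 : (0 < n)%N by exact: leq_trans rn.
have np : 0 < n%:R :> R by rewrite ltr0n.
have nu1 := coherence_ge1 sA rA r0 n0 oX coh.
have nun : 0 <= nu / n%:R by rewrite divr_ge0 ?(le_trans _ nu1) // ltW.
set P := range_proj A; set S := sgnmx A.
have [[sP PP PA trP] [sS SS PS _]] := sym_polar sA; rewrite -/P -/S in sP PP PA trP sS SS PS.
pose c1 := forall a, spectral_norm (X a) ^+ 2 <= nu / n%:R.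
have hc1 : c1 -> forall a (u : 'cV[R]_n), frob (X a *m u) (X a *m u) <= nu / n%:R * frob u u.
  by move=> h a u; exact: spectral_norm_bound.
have hmu a : frob (tproj P (X a)) (tproj P (X a)) <= 2 * nu * r%:R / n%:R.
  case: coh => [h|[h _]]; last by have := h a; rewrite frob_normK rA.
  have := frob_tproj_opnorm nun sP PP (hc1 h a); rewrite trP rA.
  by move=> h2; apply: (le_trans h2); rewrite le_eqVlt; apply/orP; left; apply/eqP; ring.
have ST : tproj P S = S.
  have SP : S *m P = S by rewrite -[S in LHS]sS -sP -trmx_mul PS sS.
  by rewrite /tproj PS SP addrK.
have inv0 : golf_inv r X P nu c1 1 S.
  split=> //; first by rewrite expr1n mul1r frobE sS SS trP rA.
  by case: coh => [h|[_ h]]; [left|right] => // a; rewrite expr1n mul1r -rA; exact: h.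
have B0 : (0 < #|{ffun 'I_K -> 'I_(n ^ 2)}|)%N.
  by rewrite card_ffun !card_ord !expn_gt0 n0.
have d0 : 0 <= 4 * (n ^ 2)%:R * 4^-1 ^+ p.+1 :> R.
  by apply: mulr_ge0; [exact: mulr_ge0|exact: exprn_ge0].
have fail := @prb_chain_fail R _ (R * 'M[R]_n)%type
  (fun st => golf_inv r X P nu c1 st.1 st.2)
  (fun st => golf_ok r X P nu c1 st.1 st.2) (golf_update X P) _ L (1, S) B0 d0
  (fun st w hi ho => golf_step PP hi ho)
  (fun st hi => prb_golf_fail n0 K0 r0 oX sP PP nu1 hmu hc1 hp hi) inv0.
have D0 : (0 < #|{: L.-tuple {ffun 'I_K -> 'I_(n ^ 2)}}|)%N by rewrite card_tuple expn_gt0 B0.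
pose im (d : L.-tuple {ffun 'I_K -> 'I_(n ^ 2)}) : {set 'I_(n ^ 2)} :=
  [set (tnth d q.1) q.2 | q : 'I_L * 'I_K].
pose act (s : {perm 'I_(n ^ 2)}) (d : L.-tuple {ffun 'I_K -> 'I_(n ^ 2)}) :=
  map_tuple (fun w : {ffun 'I_K -> 'I_(n ^ 2)} => [ffun k => s (w k)]) d.
apply: le_trans (@prb_draw_le_subset R (n ^ 2) m _ im act _ D0 mn _ _ _ _).
- rewrite (prb_not _ _ D0) lerD2l lerN2; apply: le_trans fail; apply: prb_le => d.
  apply: contra_not => h.
  apply: (golf_recovery sA K0 oX _ _ inv0 h); rewrite ?size_tuple //.
  by move=> w k /tnthP [i ->]; apply/imsetP; exists (i, k).
- move=> s d d' h; apply: eq_from_tnth => i; apply/ffunP => k.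
  have : tnth (act s d) i k = tnth (act s d') i k by rewrite h.
  by rewrite !tnth_map !ffunE => /perm_inj.
- move=> s d; rewrite /im -imset_comp; apply: eq_imset => q /=.
  by rewrite tnth_map ffunE.
- move=> d; apply: leq_trans LK; apply: leq_trans (leq_imset_card _ _) _.
  by rewrite card_prod !card_ord.
- by move=> O O'; exact: recovery_monotone.
Qed.

(** Rounding up adds at most 1, and ln n >= ln 2 >= 1/2 bounds both this 1 and the binary logarithm
    by 2 ln n. *)
Lemma up_log_ln (R : realType) (n : nat) : (1 < n)%N ->
  (up_log 2 n)%:R <= 4 * ln (n%:R : R).
Proof.
move=> n1; have np : 0 < n%:R :> R by rewrite ltr0n ltnW.
have l2 := ln2_ge_half R.
have ln2n : ln 2 <= ln n%:R :> R by rewrite ler_ln ?posrE // ler_nat.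
have u0 : (0 < up_log 2 n)%N by rewrite up_log_gt0.
have /andP [lo _] := up_log_bounds (ltnSn 1) n1.
have : (up_log 2 n).-1%:R * ln 2 <= ln n%:R :> R.
  rewrite mulr_natl -lnXn // ler_ln ?posrE ?exprn_gt0 //.
  by rewrite -natrX ler_nat ltnW.
rewrite -{2}(prednK u0) -natr1; have : 0 <= (up_log 2 n).-1%:R :> R by [].
by move: l2 ln2n; nra.
Qed.

(** Since L <= 16 ln n, the constant 512 * 288 drops to 32 * 288 for K + 1, and half of that absorbs
    the rounding of m/L. What remains, 16 * 288 = 512 * 9, matches p + 1 <= (7 + beta) ln n + 1 <= 9
    (1 + beta) ln n. *)
Lemma sampling_bounds (R : realType) (n r m : nat) (nu beta : R) :
  let L := (4 * up_log 2 n)%N in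
  (1 < n)%N -> (0 < r)%N -> 1 <= nu -> 0 < beta ->
  (512 * 288) * n%:R * r%:R * nu * (1 + beta) * ln (n%:R : R) ^+ 2 <= m%:R ->
  [/\ (0 < m %/ L)%N &
   512 * (Num.truncn ((7 + beta) * ln (n%:R : R))).+1%:R
     * (n%:R * nu * r%:R / (m %/ L)%:R) <= 1].
Proof.
move=> L n1 r0 nu1 b0 hm.
have u0 : (0 < up_log 2 n)%N by rewrite up_log_gt0.
have L0 : (0 < L)%N by rewrite muln_gt0.
have np : 0 < n%:R :> R by rewrite ltr0n ltnW.
have n1' : 1 <= n%:R :> R by rewrite ler1n ltnW.
have r1 : 1 <= r%:R :> R by rewrite ler1n.
have l2 := ln2_ge_half R.
set l := ln n%:R in hm *.
have l1 : 2^-1 <= l by apply: (le_trans l2); rewrite ler_ln ?posrE // ler_nat.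
have Ll : L%:R <= 16 * l by rewrite natrM; have := up_log_ln R n1; rewrite -/l; lra.
pose w := n%:R * r%:R * nu.
have w1 : n%:R <= w.
  by rewrite /w -[leLHS]mulr1 -mulrA ler_wpM2l ?(ltW np) // -[leLHS]mulr1 ler_pM.
have w0 : 0 < w by exact: lt_le_trans w1.
have wl0 : 0 < w * l by rewrite mulr_gt0 //; lra.
have wb : 0 < w * l * (1 + beta) by rewrite mulr_gt0 //; lra.
have hm' : (512 * 288) * (w * l * (1 + beta)) * l <= m%:R.
  by apply: le_trans hm; rewrite /w le_eqVlt; apply/orP; left; apply/eqP; ring.
set K := (m %/ L)%N.
have mK : m%:R < (K%:R + 1) * L%:R :> R.
  by rewrite natr1 -natrM ltr_nat /K mulSnr; rewrite {1}(divn_eq m L) ltn_add2l ltn_mod.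
have L0' : 0 < L%:R :> R by rewrite ltr0n.
have mK' : m%:R < (K%:R + 1) * (16 * l).
  apply: (lt_le_trans mK); rewrite ler_wpM2l //; have : 0 <= K%:R :> R by []; lra.
have l0 : 0 < l by lra.
have K9 : (32 * 288) * (w * l * (1 + beta)) < K%:R + 1.
  have : (512 * 288) * (w * l * (1 + beta)) * l < (K%:R + 1) * (16 * l) by exact: le_lt_trans mK'.
  have -> : (K%:R + 1) * (16 * l) = (K%:R + 1) * 16 * l by ring.
  by rewrite ltr_pM2r //; lra.
have wbl : 2^-1 <= w * l * (1 + beta).
  have h1 : 2^-1 <= w * l by rewrite -[leLHS]mul1r ler_pM //; lra.
  by rewrite -[leLHS]mulr1 ler_pM //; lra.
have K8 : (16 * 288) * (w * l * (1 + beta)) <= K%:R by lra.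
have Kp : 0 < K%:R :> R by lra.
split; first by rewrite -(ltr0n R).
have x0 : 0 <= (7 + beta) * l by apply: mulr_ge0; [apply: addr_ge0; [|exact: ltW]|exact: ltW].
have := truncn_le ((7 + beta) * l); rewrite x0 => tr.
rewrite mulrA ler_pdivrMr // mul1r -(natr1 (Num.truncn _)); apply: le_trans K8.
have -> : (16 * 288) * (w * l * (1 + beta)) = 512 * (9 * (1 + beta) * l) * (n%:R * nu * r%:R).
  by rewrite /w; ring.
have w0' : 0 <= n%:R * nu * r%:R by apply: ltW; move: w0; rewrite /w mulrAC.
apply: (ler_wpM2r w0'); apply: ler_wpM2l; first by rewrite ler0n.
by have := mulr_gt0 b0 l0; move: tr; lra.
Qed.

(** The exponent 7 is 3 + 4: the prefactor is at most 16 n^3, and 16 <= n^4 for n >= 2. *)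
Lemma failure_le_powR (R : realType) (n p : nat) (beta : R) :
  (1 < n)%N -> (7 + beta) * ln (n%:R : R) <= p%:R ->
  (4 * up_log 2 n)%:R * (4 * (n ^ 2)%:R * 4^-1 ^+ p) <= (n%:R : R) `^ (- beta).
Proof.
move=> n1 hp; have np : 0 < n%:R :> R by rewrite ltr0n ltnW.
have un : (up_log 2 n <= n)%N.
  by apply: up_log_min => //; rewrite ltnW // ltn_expl.
have h4 := quarter_exp_le hp.
have e7 : expR (- ((7 + beta) * ln (n%:R : R))) = (n%:R ^+ 7)^-1 * n%:R `^ (- beta).
  rewrite /powR gt_eqF // mulrDl opprD expRD mulNr; congr (_ * _).
  by rewrite expRN expRM_natl lnK.
rewrite e7 in h4.
have pw : 0 <= n%:R `^ (- beta) :> R by exact: powR_ge0.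
rewrite mulrA; apply: (@le_trans _ _ (n%:R ^+ 7 * ((n%:R ^+ 7)^-1 * n%:R `^ (- beta)))).
  apply: ler_pM => //.
  rewrite -natrM -natrM -natrX ler_nat.
  apply: (@leq_trans (4 * n * (4 * n ^ 2))); first by rewrite leq_mul2r leq_mul2l un !orbT.
  have -> : (4 * n * (4 * n ^ 2) = 2 ^ 4 * n ^ 3)%N by rewrite expnS; ring.
  by rewrite -[7%N]/(4 + 3)%N expnD leq_mul2r leq_exp2r ?n1 ?orbT.
by rewrite mulrA divff ?mul1r // expf_neq0 // gt_eqF.
Qed.

Theorem theorem4p2 (R : realType) :
  exists C : R, 0 < C /\
  forall (n r : nat) (A : 'M[R]_n) (X : 'I_(n ^ 2) -> 'M[R]_n)
         (nu beta : R) (m : nat),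
    A^T = A ->
    \rank A = r ->
    (1 <= r <= n)%N ->
    orthonormal_basis X ->
    0 < nu ->
    has_coherence A X nu ->
    0 < beta ->
    (m <= n ^ 2)%N ->
    C * n%:R * r%:R * nu * (1 + beta) * ln (n%:R : R) ^+ 2 <= m%:R ->
    1 - (n%:R : R) `^ (- beta) <=
    prob_subset R m
      (fun Omega => forall Z : 'M[R]_n, is_minimizer A X Omega Z <-> Z = A).
Proof.
exists (512 * 288); split; first by rewrite mulr_gt0 ?ltr0n.
move=> n r A X nu beta m sA rA rn oX nu0 coh b0 mn hm.
have [r0 n0] : (0 < r)%N /\ (0 < n)%N.
  by case/andP: rn => r0 rn; split=> //; exact: leq_trans rn.
(* For n = 1 the claimed probability is 1 - 1 = 0. *)
have [n1|n1] := leqP n 1.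
  have nE : n = 1%N by apply/eqP; rewrite eqn_leq n1.
  have -> : n%:R = 1 :> R by rewrite nE.
  by rewrite powR1 subrr /prob_subset divr_ge0.
have nu1 := coherence_ge1 sA rA r0 n0 oX coh.
have [K0 hK] := sampling_bounds n1 r0 nu1 b0 hm.
(* The factor 4 gives 2^L >= n^4, so 4^L >= n^8 >= 32 n^3 exceeds 8 n^2 r. *)
set L := (4 * up_log 2 n)%N in K0 hK; set p := Num.truncn _ in hK.
have L0 : (0 < L)%N by rewrite muln_gt0 up_log_gt0.
have hL : 8 * (n ^ 2)%:R * r%:R < (2 ^+ L) ^+ 2 :> R.
  have nL : (n ^ 4 <= 2 ^ L)%N by rewrite /L mulnC expnM leq_exp2r // up_logP.
  have : (8 * n ^ 2 * r < (2 ^ L) ^ 2)%N.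
    apply: (@leq_trans ((n ^ 4) ^ 2)); last by rewrite leq_exp2r.
    case/andP: rn => _ rn.
    apply: (@leq_ltn_trans (2 ^ 3 * n ^ 3)).
      by rewrite [(n ^ 3)%N]expnSr mulnA leq_mul2l rn orbT.
    rewrite -expnM -[(4 * 2)%N]/(5 + 3)%N expnD ltn_mul2r expn_gt0 n0 /=.
    apply: (@leq_trans (2 ^ 5)) => //; by rewrite leq_exp2r.
  by rewrite -(ltr_nat R) !natrM !natrX.
have LK : (L * (m %/ L) <= m)%N by rewrite mulnC leq_divM.
apply: le_trans (recovery_probability sA rA rn oX coh mn L0 K0 LK hL hK).
rewrite lerD2l lerN2; apply: failure_le_powR => //.
have x0 : 0 <= (7 + beta) * ln (n%:R : R).
  by rewrite mulr_ge0 ?ln_ge0 ?ler1n //; lra.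
(* The tail has exponent p + 1, which exceeds the truncated value (7 + beta) ln n although p itself
   may fall below it. *)
by apply: ltW; have := truncnS_gt ((7 + beta) * ln (n%:R : R)).
Qed.
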